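(* Let $d\ge2$ be an integer. For any fixed real $n>d/2+1$, one has $(G_{pn})^{1/p}\to2$ for $p\to+\infty$ ($p$ real, $p\ge n$).
   Context: Notation. $\mathbf T^d=(\mathbf R/2\pi\mathbf Z)^d$; $e_k(x)=(2\pi)^{-d/2}e^{ik\cdot x}$ for $k\in\mathbf Z^d$; $a\cdot b=\sum_ra_rb_r$ and $|a|=\sqrt{\overline a\cdot a}$ on $\mathbf C^d$; $\mathbf Z^d_0=\mathbf Z^d\setminus\{0\}$. An $\mathbf R^d$-valued distribution on $\mathbf T^d$ has a Fourier expansion $v=\sum_kv_ke_k$, $v_k=\overline{v_{-k}}\in\mathbf C^d$. For real $m$, $\mathbb H^m$ is the space of such $v$ with $k\cdot v_k=0$ for all $k$, $v_0=0$ and $\sum_{k\in\mathbf Z^d_0}|k|^{2m}|v_k|^2<\infty$, with inner product $\langle v|w\rangle_m=\sum_{k\in\mathbf Z^d_0}|k|^{2m}\overline{v_k}\cdot w_k$ and norm $\|v\|_m=\sqrt{\langle v|v\rangle_m}$. The Leray projection $\mathfrak L$ acts by $(\mathfrak Lv)_k=v_k-\frac{k\cdot v_k}{|k|^2}k$ for $k\ne0$, $(\mathfrak Lv)_0=v_0$. $\mathcal P(v,w)=\mathfrak L(v\cdot\partial w)$, $(v\cdot\partial w)_s=\sum_{r=1}^dv_r\partial_rw_s$; for $p>d/2$ it maps $\mathbb H^p\times\mathbb H^{p+1}$ to $\mathbb H^p$. For $p\ge n>d/2+1$, $G_{pn}$ is the sharp (i.e. minimum) constant $G$ such that $|\langle\mathcal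 P(v,w)|w\rangle_p|\le\frac12G(\|v\|_p\|w\|_n+\|v\|_n\|w\|_p)\|w\|_p$ for all $v\in\mathbb H^p$, $w\in\mathbb H^{p+1}$ (such constants exist). *)

(* Defs.v *)
From mathcomp Require Import all_boot all_order all_algebra.
From mathcomp Require Import complex.
From mathcomp Require Import all_classical all_reals all_analysis.
Import Order.TTheory GRing.Theory Num.Theory.
Import numFieldNormedType.Exports.

Set Implicit Arguments.
Unset Strict Implicit.
Unset Printing Implicit Defensive.

Local Open Scope classical_set_scope.
Local Open Scope complex_scope.
Local Open Scope ring_scope.

Section Summation.
Variables (R : realType) (I : choiceType).

(* Unordered sum of an absolutely summable family: [esum] is only meaningful
   for nonnegative terms, hence the positive and negative parts. *)
Definition rsum (D : set I) (f : I -> R) : R :=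
  fine (esum D (EFin \o f)^\+%E) - fine (esum D (EFin \o f)^\-%E).

Definition csum (D : set I) (f : I -> R[i]) : R[i] :=
  rsum D (fun i => complex.Re (f i)) +i* rsum D (fun i => complex.Im (f i)).

End Summation.

Section ComplexVectors.
Variables (R : realType) (d : nat).
Implicit Types a b : 'rV[R[i]]_d.

Definition dot a b : R[i] := \sum_(r < d) a 0 r * b 0 r.

Definition vconj a : 'rV[R[i]]_d := map_mx conjc a.

(* The Euclidean norm; the library norm on row vectors is the sup norm. *)
Definition vnorm a : R := Num.sqrt (complex.Re (dot (vconj a) a)).

Definition cfreq (k : 'rV[int]_d) : 'rV[R[i]]_d :=
  map_mx (fun z : int => z%:~R) k.

End ComplexVectors.

Section TorusFunctions.
Variable R : realType.

Definition basis_exp (d : nat) (k : 'rV[int]_d) (x : 'rV[R]_d) : R[i] :=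
  let t := \sum_(r < d) (k 0 r)%:~R * x 0 r in
  ((2 * pi) `^ (- (d%:R / 2)))%:C * (cos t +i* sin t).

(* The integral over T^d of a 2pi-periodic function on R^d, as an iterated
   Lebesgue integral over [0, 2pi]; it is applied to continuous functions. *)
Fixpoint torus_int (d : nat) : ('rV[R]_d -> R) -> R :=
  match d with
  | 0 => fun f => f 0
  | d'.+1 => fun f =>
      \int[@lebesgue_measure R]_(t in `[0, 2 * pi])
        torus_int (fun x : 'rV[R]_d' => f (row_mx t%:M x : 'rV[R]_(1 + d')))
  end.

Definition torus_cint (d : nat) (f : 'rV[R]_d -> R[i]) : R[i] :=
  torus_int (fun x => complex.Re (f x)) +i* torus_int (fun x => complex.Im (f x)).

End TorusFunctions.

(* A vector-valued distribution on T^d is represented by the family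
   k |-> v_k of its Fourier coefficients, so that v = \sum_k v_k e_k. *)
Definition fourier (R : realType) (d : nat) := 'rV[int]_d -> 'rV[R[i]]_d.

Section VectorFields.
Variables (R : realType) (d : nat).
Implicit Types v w : fourier R d.

Definition nonzero_freq : set 'rV[int]_d := [set k | k != 0].

Definition sobolev (m : R) : set (fourier R d) :=
  [set v | [/\ forall k, v k = vconj (v (- k)),
               forall k, dot (cfreq R k) (v k) = 0,
               v 0 = 0 &
               (\esum_(k in nonzero_freq)
                 (vnorm (cfreq R k) `^ (2 * m) * vnorm (v k) ^+ 2)%:E < +oo)%E]].

Definition sobolev_inner (m : R) v w : R[i] :=
  csum nonzero_freq (fun k =>
    (vnorm (cfreq R k) `^ (2 * m))%:C * dot (vconj (v k)) (w k)).

Definition sobolev_norm (m : R) v : R := Num.sqrt (complex.Re (sobolev_inner m v v)).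

Definition leray v : fourier R d := fun k =>
  if k == 0 then v k
  else v k - (dot (cfreq R k) (v k) / ((vnorm (cfreq R k)) ^+ 2)%:C)
             *: cfreq R k.

Definition partial (r : 'I_d) v : fourier R d :=
  fun k => ('i%C * (k 0 r)%:~R) *: v k.

(* The function x |-> \sum_k v_k e_k(x), for v with absolutely summable
   Fourier coefficients. *)
Definition torus_fun v (x : 'rV[R]_d) : 'rV[R[i]]_d :=
  \row_s csum [set: 'rV[int]_d] (fun k => v k 0 s * basis_exp k x).

Definition fourier_coef (f : 'rV[R]_d -> 'rV[R[i]]_d) : fourier R d :=
  fun k => \row_s torus_cint (fun x => f x 0 s * conjc (basis_exp k x)).

(* v . \partial w, as a pointwise product of functions. *)
Definition advect v w : fourier R d :=
  fourier_coef (fun x =>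
    \row_s \sum_(r < d) torus_fun v x 0 r * torus_fun (partial r w) x 0 s).

Definition euler_bilin v w : fourier R d := leray (advect v w).

Definition kato_bound (p n G : R) : Prop :=
  forall v w, sobolev p v -> sobolev (p + 1) w ->
    complex.Re `|sobolev_inner p (euler_bilin v w) w| <=
      2^-1 * G * (sobolev_norm p v * sobolev_norm n w +
                  sobolev_norm n v * sobolev_norm p w) * sobolev_norm p w.

End VectorFields.

(* The minimum of the constants G (which is unique when it exists); [get] picks
   an element of the set, and is unspecified on the empty set. *)
Definition kato_const (R : realType) (d : nat) (p n : R) : R :=
  get [set G : R | kato_bound d p n G /\
                   forall G', kato_bound d p n G' -> G <= G'].

(* Main.v *)
Require Import Defs.
From mathcomp Require Import all_boot all_order all_algebra.
From mathcomp Require Import complex.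
From mathcomp Require Import all_classical all_reals all_analysis.
From mathcomp Require Import ring lra zify.
Import Order.TTheory GRing.Theory Num.Theory.
Import numFieldNormedType.Exports.

(** Write [h = k - q] for lattice points and
      [X(k,q) = conj(i v_h . q) (conj(w_q) . w_k)].
    Since the product of two absolutely convergent Fourier series has the
    convolution as coefficients ([advectE]) and the Leray projection drops out
    against the solenoidal field [w],
      [<P(v,w)|w>_p = (2 pi)^(-d/2) sum_(k,q) |k|^(2p) X(k,q)].
    Because [v_h] is orthogonal to [h] and the fields are real, [X] changes sign
    under [(k,q) -> (-q,-k)]. Averaging the sum with its image gives
      [2 <P(v,w)|w>_p = (2 pi)^(-d/2) sum_(k,q) (|k|^(2p) - |q|^(2p)) X(k,q)]
    ([euler_inner_sym]), and both bounds on [G_pn] start from this identity.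

    Upper bound ([kato_upper]). Let [a = |h|] and [M >= m] be the larger and the
    smaller of [|k|], [|q|]. Then [|X| <= |v_h| m |w_q| |w_k|], and
    [(M^p - m^p) m <= p 2^p (a^p m + a m^p)] ([powR_diff_le]): the factor [2^p]
    comes from [M <= a + m <= 2 max(a,m)], and the loss of one derivative is
    avoided because [M - m <= a]. What remains are trilinear sums with two
    square summable and one summable factor. The summable one, [|k| |v_k|] or
    [|k| |w_k|], is controlled by the norm of order [n > d/2 + 1]
    ([sobolev_l1]). Hence [G_pn <= C p 2^p].

    Lower bound ([kato_lower]). For an integer [m > 0] take the modes
    [H = (m,1)], [L = (m,-1)] and [K = H + L = (2m,0)] of a coordinate plane,
    [v] supported on [H], [-H] and [w] on [L], [-L], [K], [-K], with
    amplitudes proportional to [|H|^(-p)], [|L|^(-p)], [|K|^(-p)]. All the terms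
    of the symmetrized sum are nonnegative and the term [(K,L)] alone gives
    [G_pn >= c ((|K| / |H|)^p - 1)] with [c > 0] independent of [p]. The ratio
    [|K| / |H| = 2m / sqrt(m^2 + 1)] is as close to [2] as desired.

    After extraction of the [p]-th root the factors [C p] and [c] tend to 1,
    which proves the limit. That the minimum defining [G_pn] is attained follows
    from the two bounds, since the admissible constants form a closed half-line
    ([kato_constP]). *)

Set Implicit Arguments.
Unset Strict Implicit.
Unset Printing Implicit Defensive.

Local Open Scope classical_set_scope.
Local Open Scope ring_scope.

(** * Absolutely summable real families *)

Section AbsolutelySummableFamilies.
Variable R : realType.
Implicit Types I J : choiceType.

(** Absolute summability with an explicit bound of the sum: the bound is what the
    estimates propagate, and no finiteness side condition is ever needed. *)
Definition bsum I (f : I -> R) (M : R) : Prop :=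
  (\esum_(i in [set: I]) `|f i|%:E <= M%:E)%E.

Lemma bsum_seqP I (f : I -> R) M :
  bsum f M <-> forall s : seq I, uniq s -> \sum_(i <- s) `|f i| <= M.
Proof.
split=> [fM s us | fM].
  rewrite -lee_fin; apply: le_trans fM; apply: esum_ge.
  exists [set` s]; first by split => //; exact: finite_seq.
  by rewrite -fsbig_seq// sumEFin.
apply: ge_ereal_sup => _ /= [A [finA _] <-].
by rewrite fsbig_finite//= sumEFin lee_fin; exact: fM.
Qed.

Lemma bsum_ge0 I (f : I -> R) M : bsum f M -> 0 <= M.
Proof. by move/bsum_seqP/(_ [::] isT); rewrite big_nil. Qed.

Lemma bsum_le I (f g : I -> R) M :
  (forall i, `|f i| <= `|g i|) -> bsum g M -> bsum f M.
Proof.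
by move=> fg; apply: le_trans; apply: le_esum => i _; rewrite lee_fin.
Qed.

Lemma bsum_widen I (f : I -> R) M N : M <= N -> bsum f M -> bsum f N.
Proof. by move=> MN fM; apply: le_trans fM _; rewrite lee_fin. Qed.

Lemma bsum_term I (f : I -> R) M i : bsum f M -> `|f i| <= M.
Proof. by move/bsum_seqP/(_ [:: i] isT); rewrite big_seq1. Qed.

Lemma bsumD I (f g : I -> R) M N :
  bsum f M -> bsum g N -> bsum (fun i => f i + g i) (M + N).
Proof.
move=> /bsum_seqP fM /bsum_seqP gN; apply/bsum_seqP => s us.
apply: le_trans (lerD (fM s us) (gN s us)).
by rewrite -big_split/=; apply: ler_sum => i _; exact: ler_normD.
Qed.

Lemma bsumZ I (f : I -> R) M (c : R) : bsum f M -> bsum (fun i => c * f i) (`|c| * M).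
Proof.
move=> /bsum_seqP fM; apply/bsum_seqP => s us.
under eq_bigr do rewrite normrM.
by rewrite -mulr_sumr ler_wpM2l// fM.
Qed.

Lemma bsum_reindex I J (e : J -> I) (f : I -> R) M :
  injective e -> bsum f M -> bsum (fun j => f (e j)) M.
Proof.
move=> ie /bsum_seqP fM; apply/bsum_seqP => s us.
have := fM (map e s); rewrite big_map; apply.
by rewrite map_inj_uniq.
Qed.

Lemma bsum_pair I J (F : I -> J -> R) (g : I -> R) M :
  (forall i, bsum (F i) (g i)) -> bsum g M -> bsum (fun k => F k.1 k.2) M.
Proof.
move=> Fg gM; rewrite /bsum -[setT](_ : [set: I] `*`` (fun=> [set: J]) = _);
  last by apply/seteqP; split.
rewrite -(@esum_esum _ _ _ setT (fun=> setT) (fun i j => `|F i j|%:E))//.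
apply: le_trans gM; apply: le_esum => i _.
apply: le_trans (Fg i) _; rewrite lee_fin; exact: ler_norm.
Qed.

Lemma bsum_finsupp I (f : I -> R) (s : seq I) :
  (forall i, i \notin s -> f i = 0) -> bsum f (\sum_(i <- undup s) `|f i|).
Proof.
move=> fs; apply/bsum_seqP => t ut.
rewrite (bigID (mem s))/= [X in _ + X]big1 ?addr0; last first.
  by move=> i /fs ->; rewrite normr0.
rewrite -big_filter.
have -> : \sum_(i <- undup s) `|f i| =
    \sum_(i <- undup s | i \in t) `|f i| + \sum_(i <- undup s | i \notin t) `|f i|.
  by rewrite (bigID (mem t)).
rewrite -[X in _ <= X + _]big_filter.
rewrite (@perm_big _ _ _ _ _ [seq i <- undup s | i \in t]) /= ?lerDl ?sumr_ge0//.
apply: uniq_perm; rewrite ?filter_uniq ?undup_uniq// => i.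
by rewrite !mem_filter mem_undup andbC.
Qed.

(** Cauchy-Schwarz on every finite set of indices, in the form
    [2 x y <= (B / A) x^2 + (A / B) y^2] with the weights that balance the two
    sums. *)
Lemma bsum_CS I (f g : I -> R) A B : 0 <= A -> 0 <= B ->
  bsum (fun i => f i ^+ 2) (A ^+ 2) -> bsum (fun i => g i ^+ 2) (B ^+ 2) ->
  bsum (fun i => f i * g i) (A * B).
Proof.
move=> A0 B0 fA gB; apply/bsum_seqP => s us.
have fs i : A = 0 -> f i = 0.
  move=> A00; have := bsum_term i fA; rewrite A00 expr0n/= normr_le0.
  by rewrite expf_eq0 => /andP[_ /eqP].
have gs i : B = 0 -> g i = 0.
  move=> B00; have := bsum_term i gB; rewrite B00 expr0n/= normr_le0.
  by rewrite expf_eq0 => /andP[_ /eqP].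
(* The weights [B / A] and [A / B] need both bounds to be nonzero. *)
have [A00|An0] := eqVneq A 0.
  by rewrite big1 ?mulr_ge0// => i _; rewrite fs// mul0r normr0.
have [B00|Bn0] := eqVneq B 0.
  by rewrite big1 ?mulr_ge0// => i _; rewrite gs// mulr0 normr0.
have Ap : 0 < A by rewrite lt_neqAle eq_sym An0.
have Bp : 0 < B by rewrite lt_neqAle eq_sym Bn0.
move/bsum_seqP/(_ s us): fA; move/bsum_seqP/(_ s us): gB.
set SB := \sum_(i <- s) _; set SA := \sum_(i <- s) _ => hB hA.
have h : \sum_(i <- s) `|f i * g i| <= (B / A * SA + A / B * SB) / 2.
  rewrite /SA /SB 2!mulr_sumr -big_split mulr_suml/=; apply: ler_sum => i _.
  rewrite (ger0_norm (sqr_ge0 (f i))) (ger0_norm (sqr_ge0 (g i))).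
  have := sqr_ge0 (B * `|f i| - A * `|g i|) => h.
  rewrite normrM ler_pdivlMr// -(real_normK (num_real (f i))).
  rewrite -(real_normK (num_real (g i))).
  set x := `|f i| in h *; set y := `|g i| in h *.
  have -> : B / A * x ^+ 2 + A / B * y ^+ 2 =
     ((B * x - A * y) ^+ 2) / (A * B) + x * y * 2 by field; apply/andP.
  by rewrite lerDr divr_ge0// mulr_ge0.
apply: le_trans h _; rewrite ler_pdivrMr//.
have -> : A * B * 2 = B / A * A ^+ 2 + A / B * B ^+ 2 by field; apply/andP.
by apply: lerD; apply: ler_wpM2l => //; exact: divr_ge0.
Qed.

(** Uniform smallness of tails: it reduces term-by-term integration of a series
    to finite sums. *)
Lemma bsum_tail I (f : I -> R) M (e : R) : bsum f M -> 0 < e ->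
  exists2 s : seq I, uniq s & bsum (fun i => if i \in s then 0 else f i) e.
Proof.
move=> fM e0.
have fin : (\esum_(i in [set: I]) `|f i|%:E)%E \is a fin_num.
  rewrite ge0_fin_numE; first by apply: le_lt_trans fM _; exact: ltry.
  by apply: esum_ge0 => i _; rewrite lee_fin.
set S := fine (\esum_(i in [set: I]) `|f i|%:E)%E.
have fS : bsum f S by rewrite /bsum fineK.
have [|_ [A [finA _] <-]] := ereal_sup_gt (_ : (S - e)%:E < \esum_(i in [set: I]) `|f i|%:E)%E.
  by rewrite -[X in (_ < X)%E](fineK fin) lte_fin ltrBlDr ltrDl.
rewrite fsbig_finite//= sumEFin lte_fin => hA.
exists (finmap.enum_fset (fset_set A)); first exact: finmap.fset_uniq.
apply/bsum_seqP => t ut; rewrite (bigID (mem (finmap.enum_fset (fset_set A))))/= big1 ?add0r; last first.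
  by move=> i ->; rewrite normr0.
rewrite -big_filter; set t' := [seq i <- t | _].
have -> : \sum_(i <- t') `|if i \in finmap.enum_fset (fset_set A) then 0 else f i| = \sum_(i <- t') `|f i|.
  apply: eq_big_seq => i; rewrite mem_filter => /andP[/negbTE -> //].
have : \sum_(i <- finmap.enum_fset (fset_set A) ++ t') `|f i| <= S.
  move/bsum_seqP : fS; apply.
  rewrite cat_uniq finmap.fset_uniq filter_uniq ?andbT//=.
  by apply/hasPn => i; rewrite mem_filter => /andP[].
rewrite big_cat/= => h.
move: h; rewrite -lerBrDl => /le_trans; apply.
by rewrite lerBlDl -lerBlDr ltW.
Qed.

Let esumf_fin I (f : I -> R) M : (forall i, 0 <= f i) -> bsum f M ->
  (\esum_(i in [set: I]) (f i)%:E)%E \is a fin_num.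
Proof.
move=> f0 fM; rewrite ge0_fin_numE.
  apply: le_lt_trans (ltry M); apply: le_trans fM.
  by apply: le_esum => i _; rewrite lee_fin ler_norm.
by apply: esum_ge0 => i _; rewrite lee_fin.
Qed.

Let nsum I (f : I -> R) : R := fine (\esum_(i in [set: I]) (f i)%:E)%E.

Let nsumD I (f g : I -> R) M N : (forall i, 0 <= f i) -> (forall i, 0 <= g i) ->
  bsum f M -> bsum g N -> nsum (fun i => f i + g i) = nsum f + nsum g.
Proof.
move=> f0 g0 fM gN; rewrite /nsum; under eq_esum do rewrite EFinD.
rewrite esumD.
- by rewrite fineD ?(esumf_fin f0 fM) ?(esumf_fin g0 gN).
- by move=> i _; rewrite lee_fin.
- by move=> i _; rewrite lee_fin.
Qed.

Lemma esum_bsum I (f : I -> R) M : (forall i, 0 <= f i) ->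
  bsum f M <-> (\esum_(i in [set: I]) (f i)%:E <= M%:E)%E.
Proof.
move=> f0; rewrite /bsum; under [X in (X <= _)%E]eq_esum do rewrite ger0_norm//.
by [].
Qed.

Let nsum_le I (f : I -> R) M : (forall i, 0 <= f i) -> bsum f M -> nsum f <= M.
Proof.
move=> f0 fM; rewrite -lee_fin fineK ?(esumf_fin f0 fM)//.
exact/esum_bsum.
Qed.

Let nsum_bsum I (f : I -> R) M : (forall i, 0 <= f i) -> bsum f M -> bsum f (nsum f).
Proof.
by move=> f0 fM; apply/esum_bsum; rewrite // fineK ?(esumf_fin f0 fM)//.
Qed.

Let nsum_ge0 I (f : I -> R) : (forall i, 0 <= f i) -> 0 <= nsum f.
Proof. by move=> f0; apply: fine_ge0; apply: esum_ge0 => i _; rewrite lee_fin. Qed.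

Let nsumZ I (f : I -> R) M (c : R) : 0 <= c -> (forall i, 0 <= f i) -> bsum f M ->
  nsum (fun i => c * f i) = c * nsum f.
Proof.
have H (g : I -> R) N b : 0 <= b -> (forall i, 0 <= g i) -> bsum g N ->
    nsum (fun i => b * g i) <= b * nsum g.
  move=> b0 g0 gN; rewrite -[X in _ <= X * _](ger0_norm b0).
  apply: nsum_le; first by move=> i; rewrite mulr_ge0.
  apply: bsumZ; exact: nsum_bsum gN.
move=> c0 f0 fM; apply/eqP; rewrite eq_le (H _ _ _ c0 f0 fM) /=.
have [->|cn0] := eqVneq c 0.
  by rewrite mul0r nsum_ge0// => i; rewrite mul0r.
rewrite -ler_pdivlMl; last by rewrite lt_neqAle eq_sym cn0.
have := H (fun i => c * f i) _ c^-1 _ _ (bsumZ c fM).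
rewrite invr_ge0 => /(_ c0 (fun i => mulr_ge0 c0 (f0 i))).
by under eq_fun do rewrite mulKf//.
Qed.

(** [rsum] is defined from positive and negative parts; any other decomposition
    into nonnegative summable families gives the same value. Additivity and
    Fubini follow from this, because the parts of a sum are not the sums of the
    parts. *)
Let rsum_sub I (f g : I -> R) M N : (forall i, 0 <= f i) -> (forall i, 0 <= g i) ->
  bsum f M -> bsum g N -> rsum setT (fun i => f i - g i) = nsum f - nsum g.
Proof.
move=> f0 g0 fM gN; rewrite /rsum /nsum.
have sf : summable [set: I] (EFin \o f) by apply: le_lt_trans fM _; exact: ltry.
have sg : summable [set: I] (EFin \o g) by apply: le_lt_trans gN _; exact: ltry.
have -> : (EFin \o (fun i => f i - g i)%R = (EFin \o f) \- (EFin \o g))%E by apply/funext.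
rewrite -!fineB ?(esumf_fin f0 fM) ?(esumf_fin g0 gN)//.
- congr fine; apply: esumB => //.
  + by move=> i _; rewrite lee_fin.
  + by move=> i _; rewrite lee_fin.
- have := summable_funepos (summableB sf sg); rewrite summableE.
  by under eq_esum do rewrite gee0_abs//.
- have := summable_funeneg (summableB sf sg); rewrite summableE.
  by under eq_esum do rewrite gee0_abs//.
Qed.

Let pos_part I (f : I -> R) i := (`|f i| + f i) / 2.
Let neg_part I (f : I -> R) i := (`|f i| - f i) / 2.

Let pos_ge0 I (f : I -> R) i : 0 <= pos_part f i.
Proof. by rewrite divr_ge0//; have := ler_norm (- f i); rewrite normrN; lra. Qed.
Let neg_ge0 I (f : I -> R) i : 0 <= neg_part f i.
Proof. by rewrite divr_ge0// subr_ge0 ler_norm. Qed.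
Let pos_bsum I (f : I -> R) M : bsum f M -> bsum (pos_part f) M.
Proof.
apply: bsum_le => i; rewrite ger0_norm ?pos_ge0// /pos_part ler_pdivrMr//.
by have := ler_norm (f i); lra.
Qed.
Let neg_bsum I (f : I -> R) M : bsum f M -> bsum (neg_part f) M.
Proof.
apply: bsum_le => i; rewrite ger0_norm ?neg_ge0// /neg_part ler_pdivrMr//.
by have := ler_norm (- f i); rewrite normrN; lra.
Qed.

Let rsumE I (f : I -> R) M : bsum f M ->
  rsum setT f = nsum (pos_part f) - nsum (neg_part f).
Proof.
move=> fM; rewrite -(rsum_sub (pos_ge0 f) (neg_ge0 f) (pos_bsum fM) (neg_bsum fM)).
by congr (rsum _ _); apply/funext => i; rewrite /pos_part /neg_part; lra.
Qed.

Lemma rsumD I (f g : I -> R) M N : bsum f M -> bsum g N ->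
  rsum setT (fun i => f i + g i) = rsum setT f + rsum setT g.
Proof.
move=> fM gN; rewrite (rsumE fM) (rsumE gN).
have -> : (fun i => f i + g i) = (fun i => (pos_part f i + pos_part g i) -
    (neg_part f i + neg_part g i)).
  by apply/funext => i; rewrite /pos_part /neg_part; lra.
have p := (@pos_ge0, @neg_ge0).
rewrite (rsum_sub _ _ (bsumD (pos_bsum fM) (pos_bsum gN)) (bsumD (neg_bsum fM) (neg_bsum gN))).
- rewrite (nsumD _ _ (pos_bsum fM) (pos_bsum gN)) ?p//.
  rewrite (nsumD _ _ (neg_bsum fM) (neg_bsum gN)) ?p//.
  by rewrite opprD addrACA.
- by move=> i; rewrite addr_ge0 ?p.
- by move=> i; rewrite addr_ge0 ?p.
Qed.

Lemma rsumZ I (f : I -> R) M (c : R) : bsum f M ->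
  rsum setT (fun i => c * f i) = c * rsum setT f.
Proof.
move=> fM; rewrite (rsumE fM).
have [c0|c0] := leP 0 c.
  have -> : (fun i => c * f i) = (fun i => c * pos_part f i - c * neg_part f i).
    by apply/funext => i; rewrite /pos_part /neg_part; lra.
  rewrite (rsum_sub _ _ (bsumZ c (pos_bsum fM)) (bsumZ c (neg_bsum fM))).
  - by rewrite (nsumZ _ _ (pos_bsum fM))// (nsumZ _ _ (neg_bsum fM))// mulrBr.
  - by move=> i; rewrite mulr_ge0 ?pos_ge0.
  - by move=> i; rewrite mulr_ge0 ?neg_ge0.
have d0 : 0 <= - c by lra.
have -> : (fun i => c * f i) = (fun i => (- c) * neg_part f i - (- c) * pos_part f i).
  by apply/funext => i; rewrite /pos_part /neg_part; lra.
rewrite (rsum_sub _ _ (bsumZ (-c) (neg_bsum fM)) (bsumZ (-c) (pos_bsum fM))).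
- rewrite (nsumZ _ _ (pos_bsum fM))// (nsumZ _ _ (neg_bsum fM))//; ring.
- by move=> i; rewrite mulr_ge0 ?neg_ge0.
- by move=> i; rewrite mulr_ge0 ?pos_ge0.
Qed.

Lemma rsum0 I : rsum [set: I] (fun=> 0 : R) = 0.
Proof.
have b0 : bsum (fun _ : I => 0 : R) 0.
  by apply/bsum_seqP => s _; rewrite big1// => i _; rewrite normr0.
rewrite -[RHS](mul0r (rsum [set: I] (fun=> 0))) -(rsumZ 0 b0).
by congr rsum; apply/funext => i; rewrite mul0r.
Qed.

Lemma ler_norm_rsum I (f : I -> R) M : bsum f M -> `|rsum setT f| <= M.
Proof.
move=> fM; rewrite (rsumE fM).
have : nsum (pos_part f) + nsum (neg_part f) <= M.
  rewrite -(nsumD (pos_ge0 f) (neg_ge0 f) (pos_bsum fM) (neg_bsum fM)).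
  apply: nsum_le; first by move=> i; rewrite addr_ge0 ?pos_ge0 ?neg_ge0.
    by apply: bsum_le fM => i; rewrite (_ : pos_part f i + neg_part f i = `|f i|) ?normr_id// /pos_part /neg_part; lra.
have := nsum_ge0 (pos_ge0 f); have := nsum_ge0 (neg_ge0 f).
by rewrite ler_norml => *; apply/andP; split; lra.
Qed.

Lemma rsum_ge0_bsum I (f : I -> R) M : (forall i, 0 <= f i) -> bsum f M ->
  bsum f (rsum setT f).
Proof.
move=> f0 fM; rewrite (rsumE fM).
have -> : pos_part f = f.
  by apply/funext => i; rewrite /pos_part ger0_norm//; lra.
have -> : neg_part f = fun=> 0.
  by apply/funext => i; rewrite /neg_part ger0_norm//; lra.
rewrite [X in _ - X]/nsum esum1// subr0; exact: nsum_bsum fM.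
Qed.

Lemma rsum_ge0E I (f : I -> R) M : (forall i, 0 <= f i) -> bsum f M ->
  ((rsum setT f)%:E = \esum_(i in [set: I]) (f i)%:E)%E.
Proof.
move=> f0 fM; rewrite (rsumE fM).
have -> : pos_part f = f.
  by apply/funext => i; rewrite /pos_part ger0_norm//; lra.
have -> : neg_part f = fun=> 0.
  by apply/funext => i; rewrite /neg_part ger0_norm//; lra.
by rewrite [X in _ - X]/nsum esum1// subr0 fineK// (esumf_fin f0 fM).
Qed.

Lemma bsum_finsupp_ex I (f : I -> R) (s : seq I) : (forall i, i \notin s -> f i = 0) ->
  exists M, bsum f M.
Proof. by move=> fs; exists (\sum_(i <- undup s) `|f i|); apply: bsum_finsupp. Qed.

Lemma rsum_finsupp I (f : I -> R) (s : seq I) : uniq s -> (forall i, i \notin s -> f i = 0) ->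
  rsum setT f = \sum_(i <- s) f i.
Proof.
elim: s f => [|j s IH] f us fs.
  by rewrite big_nil -[RHS](rsum0 I); congr rsum; apply/funext => i; rewrite fs.
move: us => /= /andP[js us].
pose g i := if i == j then f j else 0; pose h i := if i == j then 0 else f i.
have -> : f = (fun i => g i + h i).
  by apply/funext => i; rewrite /g /h; case: eqP => [->|_]; rewrite ?addr0 ?add0r.
have [M gM] : exists M, bsum g M.
  by apply: (@bsum_finsupp_ex _ _ [:: j]) => i; rewrite inE /g => /negbTE ->.
have hs i : i \notin s -> h i = 0.
  rewrite /h; case: eqVneq => // ij is_; apply: fs.
  by rewrite inE negb_or ij.
have [N hN] := bsum_finsupp_ex hs.
rewrite (rsumD gM hN) (IH h)// big_cons -/(g j) /h eqxx addr0; congr (_ + _); last first.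
  apply: eq_big_seq => i is_; rewrite /g; case: eqVneq => [E|_]; last by rewrite add0r.
  by rewrite E in is_; rewrite is_ in js.
(* A one-term sum is read off from the extended-real sum of a nonnegative family. *)
have g0 : 0 <= f j \/ f j < 0 by case: (leP 0 (f j)) => _; [left|right].
have E1 (c : R) : 0 <= c -> rsum [set: I] (fun i => if i == j then c else 0) = c.
  move=> c0; apply: EFin_inj.
  have [K cK] : exists K, bsum (fun i : I => if i == j then c else 0) K.
    by apply: (@bsum_finsupp_ex _ _ [:: j]) => i; rewrite inE => /negbTE ->.
  rewrite (rsum_ge0E _ cK); last by move=> i; case: ifP.
  rewrite (esumID [set j])/=; last by move=> i _; case: ifP.
  rewrite setTI esum_set1 ?eqxx// [X in (_ + X)%E]esum1 ?adde0//.
  by move=> i [_ /= /eqP /negbTE ->].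
rewrite /g eqxx; case: g0 => g0; first exact: E1.
rewrite -[RHS]opprK -mulN1r -(E1 (- f j)); last by lra.
have [K cK] : exists K, bsum (fun i : I => if i == j then - f j else 0) K.
  by apply: (@bsum_finsupp_ex _ _ [:: j]) => i; rewrite inE => /negbTE ->.
rewrite -(rsumZ _ cK); congr rsum; apply/funext => i.
by case: ifP; rewrite ?mulr0// mulN1r opprK.
Qed.

Lemma rsum_sum I K (f : K -> I -> R) (s : seq K) (M : K -> R) :
  (forall k, bsum (f k) (M k)) ->
  rsum setT (fun i => \sum_(k <- s) f k i) = \sum_(k <- s) rsum setT (f k).
Proof.
move=> fM; elim: s => [|k s IH].
  by rewrite big_nil -[RHS](rsum0 I); congr rsum; apply/funext => i; rewrite big_nil.
rewrite big_cons -IH.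
have sM : bsum (fun i => \sum_(k <- s) f k i) (\sum_(k <- s) M k).
  elim: {IH}s => [|l s IH].
    rewrite big_nil; apply/bsum_seqP => t ut.
    by rewrite big1// => i _; rewrite big_nil normr0.
  rewrite big_cons; apply: bsum_le (bsumD (fM l) IH) => i.
  by rewrite big_cons.
rewrite -(rsumD (fM k) sM); congr rsum.
by apply/funext => i; rewrite big_cons.
Qed.

Lemma rsum_reindex I J (e : J -> I) (e' : I -> J) (f : I -> R) M :
  cancel e e' -> cancel e' e -> bsum f M ->
  rsum setT (fun j => f (e j)) = rsum setT f.
Proof.
move=> ee' e'e fM; have ie := can_inj ee'.
rewrite (rsumE fM) (rsumE (bsum_reindex ie fM)) /nsum.
have be : set_bij [set: J] [set: I] e.
  by split => // [x y _ _ /ie//|i _]; exists (e' i).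
by rewrite (reindex_esum setT setT e (fun i => (pos_part f i)%:E) be)
  (reindex_esum setT setT e (fun i => (neg_part f i)%:E) be).
Qed.

(** Fubini, from the nonnegative case applied to the positive and the negative
    part. *)
Lemma rsum_pair I J (F : I -> J -> R) M : bsum (fun k => F k.1 k.2) M ->
  (forall i, bsum (F i) M) /\ bsum (fun i => rsum setT (F i)) M /\
  rsum setT (fun i => rsum setT (F i)) = rsum setT (fun k => F k.1 k.2).
Proof.
move=> FM.
have ET : [set: I] `*`` (fun=> [set: J]) = setT by apply/seteqP; split.
have Fi i : bsum (F i) M.
  by apply: (@bsum_reindex _ _ (fun j => (i, j)) _ _ _ FM) => x y [].
split=> //.
have nb (G : I -> J -> R) : (forall i j, 0 <= G i j) -> bsum (fun k => G k.1 k.2) M ->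
   bsum (fun i => nsum (G i)) M /\ nsum (fun i => nsum (G i)) = nsum (fun k => G k.1 k.2).
  move=> G0 GM.
  have E : (\esum_(i in [set: I]) (nsum (G i))%:E =
      \esum_(k in [set: I * J]) (G k.1 k.2)%:E)%E.
    rewrite -ET -(@esum_esum _ _ _ setT (fun=> setT) (fun i j => (G i j)%:E)).
      apply: eq_esum => i _; rewrite fineK// (esumf_fin (G0 i) (M := M))//.
      by apply: (@bsum_reindex _ _ (fun j => (i, j)) _ _ _ GM) => x y [].
    by move=> i j _ _; rewrite lee_fin.
  split; last by rewrite /nsum E.
  apply/esum_bsum; first by move=> i; apply: nsum_ge0.
  rewrite E; apply/esum_bsum => //.
have [pb pE] := nb (fun i j => pos_part (F i) j) (fun i j => pos_ge0 _ _) (pos_bsum FM).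
have [qb qE] := nb (fun i j => neg_part (F i) j) (fun i j => neg_ge0 _ _) (neg_bsum FM).
have rE : (fun i => rsum setT (F i)) =
   (fun i => nsum (pos_part (F i)) - nsum (neg_part (F i))).
  by apply/funext => i; rewrite (rsumE (Fi i)).
split; last first.
  rewrite rE (rsum_sub _ _ pb qb); last 2 first.
  - by move=> i; apply: nsum_ge0; exact: pos_ge0.
  - by move=> i; apply: nsum_ge0; exact: neg_ge0.
  by rewrite pE qE (rsumE FM).
have [ab _] := nb (fun i j => `|F i j|) (fun i j => normr_ge0 _)
   (bsum_le (fun k => eq_ind_r (fun x => x <= _) (lexx _) (normr_id (F k.1 k.2))) FM).
apply: bsum_le ab => i.
rewrite [X in _ <= X]ger0_norm; last by apply: nsum_ge0.
apply: ler_norm_rsum.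
have h : bsum (fun j => `|F i j|) M by apply: bsum_le (Fi i) => j; rewrite normr_id.
have := nsum_bsum (fun j => normr_ge0 (F i j)) h.
by apply: bsum_le => j; rewrite normr_id.
Qed.

Lemma rsum_cond I (D : set I) (f : I -> R) : (forall i, ~ D i -> f i = 0) ->
  rsum D f = rsum setT f.
Proof.
move=> fD; rewrite /rsum; congr (fine _ - fine _);
  rewrite esum_mkcond; apply: eq_esum => i _; rewrite ?funeposE ?funenegE /=;
  case: ifPn => //; move=> /negP; rewrite inE => /fD E; rewrite E ?oppr0; apply/esym; exact: maxxx.
Qed.

End AbsolutelySummableFamilies.

(** * Absolutely summable complex families *)

Section ComplexFamilies.
Local Open Scope complex_scope.
Import Normc.
Variable R : realType.
Implicit Types I J : choiceType.

Lemma normc_ge0 (z : R[i]) : 0 <= normc z.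
Proof. by case: z => a b; exact: sqrtr_ge0. Qed.

Lemma normcE (z : R[i]) : complex.Re `|z| = normc z.
Proof. by rewrite normc_def; case: z. Qed.

Lemma ler_Re_normc (z : R[i]) : `|complex.Re z| <= normc z.
Proof.
case: z => a b /=; rewrite -sqrtr_sqr ler_wsqrtr// lerDl; exact: sqr_ge0.
Qed.

Lemma ler_Im_normc (z : R[i]) : `|complex.Im z| <= normc z.
Proof.
case: z => a b /=; rewrite -sqrtr_sqr ler_wsqrtr// lerDr; exact: sqr_ge0.
Qed.

Lemma normc_le_ReIm (z : R[i]) : normc z <= `|complex.Re z| + `|complex.Im z|.
Proof.
case: z => a b /=; rewrite -[X in _ <= X]ger0_norm ?addr_ge0// -sqrtr_sqr.
rewrite ler_wsqrtr// sqrrD !real_normK ?num_real// addrAC lerDl.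
by rewrite mulrn_wge0// mulr_ge0.
Qed.

Lemma normc_conj (z : R[i]) : normc z^* = normc z.
Proof. by case: z => a b /=; rewrite sqrrN. Qed.

Lemma normc_real (x : R) : normc x%:C = `|x|.
Proof. by rewrite /= expr0n/= addr0 sqrtr_sqr. Qed.

Lemma normci : normc ('i : R[i]) = 1.
Proof. by rewrite /= expr0n/= add0r expr1n sqrtr1. Qed.

Lemma normc_triangle (x y : R[i]) : normc (x + y) <= normc x + normc y.
Proof. exact: le_normcD. Qed.

Lemma normc_sum K (s : seq K) (f : K -> R[i]) :
  normc (\sum_(k <- s) f k) <= \sum_(k <- s) normc (f k).
Proof.
elim: s => [|k s IH]; first by rewrite !big_nil normc0.
by rewrite !big_cons; apply: le_trans (normc_triangle _ _) _; rewrite lerD2l.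
Qed.

Lemma complexP (x y : R[i]) : complex.Re x = complex.Re y ->
  complex.Im x = complex.Im y -> x = y.
Proof. by case: x y => a b [c e] /= -> ->. Qed.

Lemma cReM (x y : R[i]) : complex.Re (x * y) =
  complex.Re x * complex.Re y - complex.Im x * complex.Im y.
Proof. by case: x y => a b [c e]. Qed.

Lemma cImM (x y : R[i]) : complex.Im (x * y) =
  complex.Re x * complex.Im y + complex.Im x * complex.Re y.
Proof. by case: x y => a b [c e]. Qed.

Lemma cReD (x y : R[i]) : complex.Re (x + y) = complex.Re x + complex.Re y.
Proof. by case: x y => a b [c e]. Qed.

Lemma cImD (x y : R[i]) : complex.Im (x + y) = complex.Im x + complex.Im y.
Proof. by case: x y => a b [c e]. Qed.

Lemma Re_sum K (s : seq K) (f : K -> R[i]) :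
  complex.Re (\sum_(k <- s) f k) = \sum_(k <- s) complex.Re (f k).
Proof. by elim: s => [|k s IH]; rewrite ?big_nil// !big_cons cReD IH. Qed.

Lemma Im_sum K (s : seq K) (f : K -> R[i]) :
  complex.Im (\sum_(k <- s) f k) = \sum_(k <- s) complex.Im (f k).
Proof. by elim: s => [|k s IH]; rewrite ?big_nil// !big_cons cImD IH. Qed.

Definition cbsum I (f : I -> R[i]) (M : R) : Prop := bsum (fun i => normc (f i)) M.

Lemma cbsum_Re I (f : I -> R[i]) M : cbsum f M -> bsum (fun i => complex.Re (f i)) M.
Proof. by apply: bsum_le => i; rewrite [leRHS]ger0_norm ?normc_ge0// ler_Re_normc. Qed.

Lemma cbsum_Im I (f : I -> R[i]) M : cbsum f M -> bsum (fun i => complex.Im (f i)) M.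
Proof. by apply: bsum_le => i; rewrite [leRHS]ger0_norm ?normc_ge0// ler_Im_normc. Qed.

Lemma cbsum_le I (f : I -> R[i]) (g : I -> R) M :
  (forall i, normc (f i) <= `|g i|) -> bsum g M -> cbsum f M.
Proof. by move=> fg; apply: bsum_le => i; rewrite ger0_norm ?normc_ge0. Qed.

Lemma cbsumD I (f g : I -> R[i]) M N :
  cbsum f M -> cbsum g N -> cbsum (fun i => f i + g i) (M + N).
Proof.
move=> fM gN; apply: cbsum_le (bsumD fM gN) => i.
by rewrite ger0_norm ?addr_ge0 ?normc_ge0// normc_triangle.
Qed.

Lemma cbsumZ I (f : I -> R[i]) M (c : R[i]) :
  cbsum f M -> cbsum (fun i => c * f i) (normc c * M).
Proof.
move=> /(bsumZ (normc c)); rewrite ger0_norm ?normc_ge0//.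
by apply: bsum_le => i; rewrite normcM.
Qed.

Lemma cbsum_sum I K (f : K -> I -> R[i]) (s : seq K) (M : K -> R) :
  (forall k, cbsum (f k) (M k)) ->
  cbsum (fun i => \sum_(k <- s) f k i) (\sum_(k <- s) M k).
Proof.
move=> fM; elim: s => [|l s IH].
  rewrite big_nil; apply/bsum_seqP => t ut.
  by rewrite big1// => i _; rewrite big_nil normc0 normr0.
rewrite big_cons; apply: bsum_le (cbsumD (fM l) IH) => i.
by rewrite big_cons.
Qed.

Lemma csumD I (f g : I -> R[i]) M N : cbsum f M -> cbsum g N ->
  csum setT (fun i => f i + g i) = csum setT f + csum setT g.
Proof.
move=> fM gN; apply: complexP; rewrite ?cReD ?cImD /=.
  rewrite -(rsumD (cbsum_Re fM) (cbsum_Re gN)); congr rsum.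
  by apply/funext => i; rewrite cReD.
rewrite -(rsumD (cbsum_Im fM) (cbsum_Im gN)); congr rsum.
by apply/funext => i; rewrite cImD.
Qed.

Lemma csumZ I (f : I -> R[i]) M (c : R[i]) : cbsum f M ->
  csum setT (fun i => c * f i) = c * csum setT f.
Proof.
move=> fM; have fR := cbsum_Re fM; have fI := cbsum_Im fM.
apply: complexP; rewrite ?cReM ?cImM /=.
  rewrite -mulNr -(rsumZ _ fR) -(rsumZ _ fI) -(rsumD (bsumZ _ fR) (bsumZ _ fI)).
  by congr rsum; apply/funext => i; rewrite cReM mulNr.
rewrite -(rsumZ _ fR) -(rsumZ _ fI) -(rsumD (bsumZ _ fI) (bsumZ _ fR)).
by congr rsum; apply/funext => i; rewrite cImM.
Qed.

Lemma csum_conj I (f : I -> R[i]) M : cbsum f M ->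
  csum setT (fun i => (f i)^*) = (csum setT f)^*.
Proof.
move=> fM; apply: complexP => /=.
  by congr rsum; apply/funext => i; case: (f i).
rewrite -mulN1r -(rsumZ _ (cbsum_Im fM)); congr rsum.
by apply/funext => i; rewrite mulN1r; case: (f i).
Qed.

Lemma csum_sum I K (f : K -> I -> R[i]) (s : seq K) (M : K -> R) :
  (forall k, cbsum (f k) (M k)) ->
  csum setT (fun i => \sum_(k <- s) f k i) = \sum_(k <- s) csum setT (f k).
Proof.
move=> fM; apply: complexP; rewrite ?Re_sum ?Im_sum /=.
  rewrite -(rsum_sum s (fun k => cbsum_Re (fM k))); congr rsum.
  by apply/funext => i; rewrite Re_sum.
rewrite -(rsum_sum s (fun k => cbsum_Im (fM k))); congr rsum.
by apply/funext => i; rewrite Im_sum.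
Qed.

Lemma csum_reindex I J (e : J -> I) (e' : I -> J) (f : I -> R[i]) M :
  cancel e e' -> cancel e' e -> cbsum f M ->
  csum setT (fun j => f (e j)) = csum setT f.
Proof.
move=> ee' e'e fM; rewrite /csum.
by rewrite (rsum_reindex ee' e'e (cbsum_Re fM)) (rsum_reindex ee' e'e (cbsum_Im fM)).
Qed.

(** The factors 2 here and in [normc_csum] come from treating the real and the
    imaginary part separately; only the growth rate of the constants in [p]
    matters. *)
Lemma csum_pair I J (F : I -> J -> R[i]) M : cbsum (fun k => F k.1 k.2) M ->
  (forall i, cbsum (F i) M) /\ cbsum (fun i => csum setT (F i)) (2 * M) /\
  csum setT (fun i => csum setT (F i)) = csum setT (fun k => F k.1 k.2).
Proof.
move=> FM.
have [fR [bR eR]] := rsum_pair (F := fun i j => complex.Re (F i j)) (cbsum_Re FM).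
have [fI [bI eI]] := rsum_pair (F := fun i j => complex.Im (F i j)) (cbsum_Im FM).
split; last split.
- by move=> i; apply: (@bsum_reindex _ _ _ (fun j => (i, j)) _ _ _ FM) => x y [].
- rewrite mulrDl mul1r.
  have aR : bsum (fun i => `|rsum setT (fun j => complex.Re (F i j))|) M.
    by apply: bsum_le bR => i; rewrite normr_id.
  have aI : bsum (fun i => `|rsum setT (fun j => complex.Im (F i j))|) M.
    by apply: bsum_le bI => i; rewrite normr_id.
  apply: cbsum_le (bsumD aR aI) => i.
  by rewrite ger0_norm ?addr_ge0//; apply: le_trans (normc_le_ReIm _) _.
- by rewrite /csum /= eR eI.
Qed.

Lemma normc_csum I (f : I -> R[i]) M : cbsum f M -> normc (csum setT f) <= 2 * M.
Proof.
move=> fM; apply: le_trans (normc_le_ReIm _) _; rewrite mulrDl mul1r.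
by apply: lerD; apply: ler_norm_rsum; [exact: cbsum_Re|exact: cbsum_Im].
Qed.

Lemma csum_finsupp I (f : I -> R[i]) (s : seq I) : uniq s ->
  (forall i, i \notin s -> f i = 0) -> csum setT f = \sum_(i <- s) f i.
Proof.
move=> us fs; apply: complexP; rewrite ?Re_sum ?Im_sum /=.
  by apply: rsum_finsupp => // i /fs ->.
by apply: rsum_finsupp => // i /fs ->.
Qed.

Lemma csum_cond I (D : set I) (f : I -> R[i]) : (forall i, ~ D i -> f i = 0) ->
  csum D f = csum setT f.
Proof.
by move=> fD; congr (_ +i* _); apply: rsum_cond => i /fD ->.
Qed.

Lemma cbsum_prod I J (f : I -> R[i]) (g : J -> R[i]) M N :
  cbsum f M -> cbsum g N -> cbsum (fun k => f k.1 * g k.2) (M * N).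
Proof.
move=> fM gN; have N0 := bsum_ge0 gN.
apply: (@bsum_pair _ _ _ (fun i j => normc (f i * g j)) (fun i => N * normc (f i))).
  by move=> i; rewrite mulrC; exact: cbsumZ.
by rewrite mulrC -{2}(ger0_norm N0); exact: bsumZ.
Qed.

Lemma csum_prod I J (f : I -> R[i]) (g : J -> R[i]) M N :
  cbsum f M -> cbsum g N ->
  csum setT f * csum setT g = csum setT (fun k => f k.1 * g k.2).
Proof.
move=> fM gN; have [_ [_ <-]] := csum_pair (F := fun i j => f i * g j) (cbsum_prod fM gN).
rewrite mulrC -(csumZ _ fM); congr csum; apply/funext => i.
by rewrite (csumZ _ gN) mulrC.
Qed.

End ComplexFamilies.

(** * Complex vectors and lattice points *)

Section ComplexVectors.
Local Open Scope complex_scope.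
Import Normc.
Variables (R : realType) (d : nat).
Implicit Types (a b : 'rV[R[i]]_d) (k q : 'rV[int]_d).

Lemma sqr_normcE (z : R[i]) : normc z ^+ 2 = complex.Re z ^+ 2 + complex.Im z ^+ 2.
Proof. by case: z => x y; rewrite sqr_sqrtr// addr_ge0 ?sqr_ge0. Qed.

Lemma vnorm_ge0 a : 0 <= vnorm a.
Proof. exact: sqrtr_ge0. Qed.

Let dot_conj_self a : complex.Re (dot (vconj a) a) = \sum_(r < d) normc (a 0 r) ^+ 2.
Proof.
rewrite /dot Re_sum; apply: eq_bigr => r _; rewrite mxE cReM sqr_normcE.
by case: (a 0 r) => x y /=; ring.
Qed.

Lemma sqr_vnormE a : vnorm a ^+ 2 = complex.Re (dot (vconj a) a).
Proof.
by rewrite sqr_sqrtr// dot_conj_self sumr_ge0// => r _; exact: sqr_ge0.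
Qed.

Lemma sqr_vnorm a : vnorm a ^+ 2 = \sum_(r < d) normc (a 0 r) ^+ 2.
Proof. by rewrite sqr_vnormE dot_conj_self. Qed.

Lemma normc_le_vnorm a r : normc (a 0 r) <= vnorm a.
Proof.
rewrite -(@ler_pXn2r _ 2) ?nnegrE ?vnorm_ge0 ?normc_ge0// sqr_vnorm.
rewrite (bigD1 r)//= lerDl sumr_ge0// => i _; exact: sqr_ge0.
Qed.

Lemma dotC a b : dot a b = dot b a.
Proof. by apply: eq_bigr => r _; rewrite mulrC. Qed.

Lemma dotDr a b c : dot a (b + c) = dot a b + dot a c.
Proof. by rewrite /dot -big_split; apply: eq_bigr => r _; rewrite mxE mulrDr. Qed.

Lemma dotZr a z b : dot a (z *: b) = z * dot a b.
Proof. by rewrite /dot mulr_sumr; apply: eq_bigr => r _; rewrite mxE mulrCA. Qed.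

Lemma dotNr a b : dot a (- b) = - dot a b.
Proof. by rewrite -scaleN1r dotZr mulN1r. Qed.

Lemma dot0r a : dot a 0 = 0.
Proof. by rewrite /dot big1// => r _; rewrite mxE mulr0. Qed.

Lemma vconjK a : vconj (vconj a) = a.
Proof. by apply/rowP => r; rewrite !mxE conjcK. Qed.

Lemma vnorm_vconj a : vnorm (vconj a) = vnorm a.
Proof.
rewrite /vnorm !dot_conj_self; congr Num.sqrt; apply: eq_bigr => r _.
by rewrite mxE normc_conj.
Qed.

Lemma vnorm0 : vnorm (0 : 'rV[R[i]]_d) = 0.
Proof. by rewrite /vnorm dot0r sqrtr0. Qed.

Lemma normc_dot a b : normc (dot a b) <= vnorm a * vnorm b.
Proof.
apply: le_trans (normc_sum _ _) _.
under eq_bigr do rewrite normcM.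
have H (x : 'rV[R[i]]_d) : bsum (fun r : 'I_d => normc (x 0 r) ^+ 2) (vnorm x ^+ 2).
  rewrite sqr_vnorm; apply/bsum_seqP => s us.
  under eq_bigr do rewrite ger0_norm ?sqr_ge0//.
  rewrite big_uniq// [leRHS](bigID (mem s))/= lerDl sumr_ge0// => r _.
  exact: sqr_ge0.
have /bsum_seqP := bsum_CS (vnorm_ge0 a) (vnorm_ge0 b) (H a) (H b).
move=> /(_ (index_enum 'I_d) (index_enum_uniq _)); apply: le_trans.
by apply: ler_sum => r _; exact: ler_norm.
Qed.

Definition freq_norm k : R := vnorm (cfreq R k).

Lemma cfreqD k q : cfreq R (k + q) = cfreq R k + cfreq R q.
Proof. by apply/rowP => r; rewrite !mxE rmorphD. Qed.

Lemma cfreqN k : cfreq R (- k) = - cfreq R k.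
Proof. by apply/rowP => r; rewrite !mxE rmorphN. Qed.

Lemma int_real_complex (z : int) : (z%:~R : R[i]) = (z%:~R : R)%:C.
Proof. by rewrite (rmorph_int (real_complex R)). Qed.

Lemma freq_norm_ge0 k : 0 <= freq_norm k.
Proof. exact: vnorm_ge0. Qed.

Lemma sqr_freq_norm k : freq_norm k ^+ 2 = \sum_(r < d) (k 0 r)%:~R ^+ 2.
Proof.
rewrite sqr_vnorm; apply: eq_bigr => r _.
by rewrite mxE int_real_complex normc_real real_normK ?num_real.
Qed.

Lemma freq_normN k : freq_norm (- k) = freq_norm k.
Proof.
apply/eqP; rewrite -(@eqrXn2 _ 2) ?freq_norm_ge0// !sqr_freq_norm; apply/eqP.
by apply: eq_bigr => r _; rewrite mxE rmorphN sqrrN.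
Qed.

Lemma freq_norm0 : freq_norm 0 = 0.
Proof.
apply/eqP; rewrite -(@eqrXn2 _ 2) ?freq_norm_ge0// sqr_freq_norm big1 ?expr0n// => r _.
by rewrite mxE expr0n.
Qed.

Lemma ler_freq_norm k r : `|(k 0 r)%:~R| <= freq_norm k.
Proof.
rewrite -(@ler_pXn2r _ 2) ?nnegrE ?freq_norm_ge0// sqr_freq_norm real_normK ?num_real//.
rewrite (bigD1 r)//= lerDl sumr_ge0// => i _; exact: sqr_ge0.
Qed.

Lemma freq_norm_ge1 k : k != 0 -> 1 <= freq_norm k.
Proof.
move=> k0; have [r kr] : exists r, k 0 r != 0.
  apply/existsP; apply: contraNT k0 => /existsPn k0; apply/eqP/rowP => r.
  by rewrite mxE; apply/eqP; rewrite -[_ == _]negbK k0.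
apply: le_trans (ler_freq_norm k r); rewrite -intr_norm (_ : 1 = 1%:~R)// ler_int.
by lia.
Qed.

Lemma freq_normD k q : freq_norm (k + q) <= freq_norm k + freq_norm q.
Proof.
rewrite -(@ler_pXn2r _ 2) ?nnegrE ?addr_ge0 ?freq_norm_ge0// sqr_freq_norm sqrrD !sqr_freq_norm.
under eq_bigr do rewrite mxE rmorphD sqrrD.
rewrite 2!big_split/= lerD2r lerD2l sumrMnl ler_wMn2r//.
apply: le_trans (ler_norm _) _.
suff <- : normc (dot (cfreq R k) (cfreq R q)) = `|\sum_(r < d) (k 0 r)%:~R * (q 0 r)%:~R|.
  exact: normc_dot.
rewrite -normc_real rmorph_sum/=; congr normc; apply: eq_bigr => r _.
by rewrite !mxE !int_real_complex rmorphM.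
Qed.

End ComplexVectors.

(** * Integration of Fourier series over the torus *)

Section TorusIntegral.
Local Open Scope complex_scope.
Import Normc.
Variable R : realType.
Local Notation mu := (@lebesgue_measure R).

(** Uniform continuity on the whole space, coordinate by coordinate: unlike
    continuity it passes from a function of [d + 1] variables to its partial
    integrals without any compactness argument. *)
Definition ucont d (f : 'rV[R]_d -> R) : Prop := forall e : R, 0 < e ->
  exists2 D : R, 0 < D & forall x y : 'rV[R]_d,
    (forall i, `|x 0 i - y 0 i| < D) -> `|f x - f y| <= e.

Lemma ucont_cst d (c : R) : ucont (fun _ : 'rV[R]_d => c).
Proof. by move=> e e0; exists 1 => // x y _; rewrite subrr normr0 ltW. Qed.

Lemma ucontD d (f g : 'rV[R]_d -> R) : ucont f -> ucont g ->
  ucont (fun x => f x + g x).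
Proof.
move=> uf ug e e0; have e2 : 0 < e / 2 by rewrite divr_gt0.
have [D1 D10 h1] := uf _ e2; have [D2 D20 h2] := ug _ e2.
exists (Num.min D1 D2); first by rewrite lt_min D10.
move=> x y xy; have -> : f x + g x - (f y + g y) = (f x - f y) + (g x - g y) by ring.
apply: le_trans (ler_normD _ _) _; rewrite [leRHS](splitr e).
by apply: lerD; [apply: h1|apply: h2] => i; have := xy i; rewrite lt_min => /andP[].
Qed.

Lemma ucontZ d (f : 'rV[R]_d -> R) (c : R) : ucont f -> ucont (fun x => c * f x).
Proof.
move=> uf e e0; have c0 : 0 < `|c| + 1 by rewrite ltr_wpDl.
have [D D0 h] := uf _ (divr_gt0 e0 c0).
exists D => // x y /h; rewrite -mulrBr normrM ler_pdivlMr// mulrC; apply: le_trans.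
by rewrite ler_wpM2r// lerDl.
Qed.

Lemma ucont_sum d K (s : seq K) (f : K -> 'rV[R]_d -> R) : (forall k, ucont (f k)) ->
  ucont (fun x => \sum_(k <- s) f k x).
Proof.
move=> uf; elim: s => [|k s IH].
  by under eq_fun do rewrite big_nil; exact: ucont_cst.
by under eq_fun do rewrite big_cons; exact: ucontD.
Qed.

Lemma ucont_unif d (f : 'rV[R]_d -> R) :
  (forall e : R, 0 < e -> exists2 g, ucont g & forall x, `|f x - g x| <= e) -> ucont f.
Proof.
move=> H e e0; have e3 : 0 < e / 3 by rewrite divr_gt0.
have [g ug fg] := H _ e3; have [D D0 h] := ug _ e3.
exists D => // x y /h gxy.
have -> : f x - f y = (f x - g x) + ((g x - g y) - (f y - g y)) by ring.
have -> : e = e / 3 + (e / 3 + e / 3) by field.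
apply: le_trans (ler_normD _ _) _; apply: lerD => //.
by apply: le_trans (ler_normB _ _) _; apply: lerD.
Qed.

Let slice d (f : 'rV[R]_d.+1 -> R) (t : R) : 'rV[R]_d -> R :=
  fun x => f (row_mx t%:M x : 'rV[R]_(1 + d)).

Let row_mx_bound d (t s D : R) (x y : 'rV[R]_d) : `|t - s| < D ->
  (forall i, `|x 0 i - y 0 i| < D) ->
  forall i, `|(row_mx t%:M x : 'rV[R]_(1 + d)) 0 i -
     (row_mx s%:M y : 'rV[R]_(1 + d)) 0 i| < D.
Proof.
move=> ts xy i; rewrite !mxE; case: (fintype.split i) => j //.
by rewrite !mxE (ord1 j) eqxx !mulr1n.
Qed.

Let ucont_slice d (f : 'rV[R]_d.+1 -> R) t : ucont f -> ucont (slice f t).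
Proof.
move=> uf e e0; have [D D0 h] := uf _ e0; exists D => // x y xy.
by apply: h; apply: row_mx_bound => //; rewrite subrr normr0.
Qed.

Let pi2_gt0 : 0 < 2 * pi :> R.
Proof. by rewrite mulr_gt0// pi_gt0. Qed.

Let cont_integrable (g : R -> R) : continuous g ->
  mu.-integrable `[0, 2 * pi] (EFin \o g).
Proof.
move=> cg; apply: continuous_compact_integrable; first exact: segment_compact.
exact: continuous_subspaceT.
Qed.

Let Rint_lin (f g : R -> R) c : continuous f -> continuous g ->
  \int[mu]_(t in `[0, 2 * pi]) (c * f t + g t) =
  c * \int[mu]_(t in `[0, 2 * pi]) f t + \int[mu]_(t in `[0, 2 * pi]) g t.
Proof.
move=> cf cg; rewrite RintegralD//; last 2 first.
- by apply: cont_integrable => x; apply: cvgM; [exact: cvg_cst|exact: cf].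
- exact: cont_integrable.
by rewrite RintegralZl//; exact: cont_integrable.
Qed.

Let Rint_le (f : R -> R) (M : R) : continuous f -> (forall t, `|f t| <= M) ->
  `|\int[mu]_(t in `[0, 2 * pi]) f t| <= 2 * pi * M.
Proof.
move=> cf fM; apply: le_trans (le_normr_Rintegral _ _) _ => //.
  exact: cont_integrable.
apply: (@le_trans _ _ (\int[mu]_(t in `[0, 2 * pi]) M)).
  apply: le_Rintegral => //.
  - by apply: cont_integrable => x; apply: cvg_norm; exact: cf.
  - by apply: cont_integrable => x; exact: cvg_cst.
rewrite Rintegral_cst//= lebesgue_measure_itv/= lte_fin pi2_gt0 /=.
by rewrite subr0 mulrC.
Qed.

(** Linearity and the sup bound have to be proved together: the bound is what
    makes the inner integral depend continuously on the outer variable. *)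
Let torus_int_main d : forall f g : 'rV[R]_d -> R, ucont f -> ucont g ->
  (forall c, torus_int (fun x => c * f x + g x) = c * torus_int f + torus_int g) /\
  (forall M : R, (forall x, `|f x| <= M) -> `|torus_int f| <= (2 * pi) ^+ d * M).
Proof.
elim: d => [|d IH] f g uf ug.
  by split=> // M fM; rewrite expr0 mul1r; exact: fM.
have cont (h : 'rV[R]_d.+1 -> R) : ucont h -> continuous (fun t => torus_int (slice h t)).
  move=> uh t; apply/cvgrPdist_le => e e0.
  pose K : R := (2 * pi) ^+ d; have K0 : 0 < K by rewrite exprn_gt0.
  have [D D0 hD] := uh _ (divr_gt0 e0 K0).
  apply/nbhs_ballP; exists D => //= s ts.
  have -> : torus_int (slice h t) - torus_int (slice h s) =
      torus_int (fun x => (-1) * slice h s x + slice h t x).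
    have [-> _] := IH _ _ (ucont_slice s uh) (ucont_slice t uh).
    by rewrite mulN1r addrC.
  have uD : ucont (fun x => (-1) * slice h s x + slice h t x).
    by apply: ucontD; [apply: ucontZ|]; exact: ucont_slice.
  have [_ B] := IH _ _ uD uD.
  have := B (e / K); rewrite mulrCA divff ?mulr1 ?gt_eqF//; apply => x.
  rewrite mulN1r addrC; apply: hD; apply: row_mx_bound => // i.
  by rewrite subrr normr0.
split=> [c|M fM].
  rewrite /= -(Rint_lin _ (cont _ uf) (cont _ ug)); congr Rintegral.
  apply/funext => t.
  by have [-> _] := IH _ _ (ucont_slice t uf) (ucont_slice t ug).
rewrite exprS -mulrA; apply: Rint_le; first exact: cont.
move=> t; have [_] := IH _ _ (ucont_slice t uf) (ucont_slice t uf).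
by apply => x; exact: fM.
Qed.

Lemma torus_int_lin d (f g : 'rV[R]_d -> R) c : ucont f -> ucont g ->
  torus_int (fun x => c * f x + g x) = c * torus_int f + torus_int g.
Proof. by move=> uf ug; have [-> _] := torus_int_main uf ug. Qed.

Lemma torus_int_bound d (f : 'rV[R]_d -> R) M : ucont f -> (forall x, `|f x| <= M) ->
  `|torus_int f| <= (2 * pi) ^+ d * M.
Proof. by move=> uf; have [_] := torus_int_main uf uf; apply. Qed.

Lemma torus_int_sum d K (s : seq K) (f : K -> 'rV[R]_d -> R) :
  (forall k, ucont (f k)) ->
  torus_int (fun x => \sum_(k <- s) f k x) = \sum_(k <- s) torus_int (f k).
Proof.
move=> uf; elim: s => [|k s IH].
  rewrite big_nil; under eq_fun do rewrite big_nil.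
  apply/eqP; rewrite -normr_le0.
  have := torus_int_bound (@ucont_cst d 0) (M := 0).
  by rewrite mulr0; apply => x; rewrite normr0.
rewrite big_cons -IH -[in RHS](mul1r (torus_int (f k))) -torus_int_lin//; last exact: ucont_sum.
by congr torus_int; apply/funext => x; rewrite big_cons mul1r.
Qed.

(** The error of a partial sum is bounded uniformly by a tail of [b], and
    [torus_int] is continuous for the sup norm. *)
Lemma torus_int_rsum d (I : choiceType) (f : I -> 'rV[R]_d -> R) b M :
  (forall i, ucont (f i)) -> (forall i x, `|f i x| <= b i) -> bsum b M ->
  torus_int (fun x => rsum setT (fun i => f i x)) = rsum setT (fun i => torus_int (f i)).
Proof.
move=> uf fb bM; pose K : R := (2 * pi) ^+ d; have K0 : 0 < K by rewrite exprn_gt0.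
have fx x : bsum (fun i => f i x) M.
  by apply: bsum_le bM => i; apply: le_trans (fb _ _) (ler_norm _).
have bJ : bsum (fun i => torus_int (f i)) (K * M).
  rewrite -(ger0_norm (ltW K0)); apply: bsum_le (bsumZ K bM) => i.
  rewrite normrM (ger0_norm (ltW K0)); apply: torus_int_bound => // x.
  by apply: le_trans (fb _ _) (ler_norm _).
have cut (g : I -> R) N (s : seq I) : uniq s -> bsum g N ->
    rsum setT g - \sum_(i <- s) g i = rsum setT (fun i => if i \in s then 0 else g i).
  move=> us gN.
  have [N' gN'] : exists N', bsum (fun i => if i \in s then g i else 0) N'.
    by apply: (bsum_finsupp_ex (s := s)) => i /negbTE ->.
  have gN2 : bsum (fun i => if i \in s then 0 else g i) N.
    by apply: bsum_le gN => i; case: ifP; rewrite ?normr0.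
  have -> : \sum_(i <- s) g i = rsum setT (fun i => if i \in s then g i else 0).
    rewrite (rsum_finsupp us); last by move=> i /negbTE ->.
    by apply: eq_big_seq => i ->.
  apply/eqP; rewrite subr_eq addrC -(rsumD gN' gN2); apply/eqP; congr rsum.
  by apply/funext => i; case: ifP; rewrite ?addr0 ?add0r.
have close e : 0 < e -> exists2 s : seq I, uniq s &
    (forall x, `|rsum setT (fun i => f i x) - \sum_(i <- s) f i x| <= e) /\
    `|rsum setT (fun i => torus_int (f i)) - \sum_(i <- s) torus_int (f i)| <= K * e.
  move=> e0; have [s us sb] := bsum_tail bM e0; exists s => //; split=> [x|].
    rewrite (cut _ _ _ us (fx x)); apply: ler_norm_rsum.
    apply: bsum_le sb => i; case: ifP => // _.
    by apply: le_trans (fb _ _) (ler_norm _).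
  rewrite (cut _ _ _ us bJ); apply: ler_norm_rsum.
  rewrite -(ger0_norm (ltW K0)); apply: bsum_le (bsumZ K sb) => i.
  case: ifP => _; first by rewrite normr0.
  rewrite normrM (ger0_norm (ltW K0)); apply: torus_int_bound => // x.
  by apply: le_trans (fb _ _) (ler_norm _).
have uS : ucont (fun x => rsum setT (fun i => f i x)).
  apply: ucont_unif => e /close[s us [h _]].
  by exists (fun x => \sum_(i <- s) f i x) => //; exact: ucont_sum.
apply/eqP; rewrite -subr_eq0 -normr_le0; apply/ler_addgt0Pr => e e0.
have [s us [h1 h2]] := close _ (divr_gt0 e0 (mulr_gt0 (ltr0Sn R 1) K0)).
have us' := ucont_sum s uf.
have uD : ucont (fun x => (-1) * (\sum_(i <- s) f i x) + rsum setT (fun i => f i x)).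
  by apply: ucontD => //; exact: ucontZ.
have := torus_int_bound uD (M := e / (2 * K)).
rewrite torus_int_lin// torus_int_sum// => h3.
have {}h3 : `|- 1 * (\sum_(i <- s) torus_int (f i)) +
    torus_int (fun x : 'rV_d => rsum [set: I] (fun i => f i x))| <= K * (e / (2 * K)).
  by apply: h3 => x; rewrite mulN1r addrC.
have E : K * (e / (2 * K)) = e / 2 by field; rewrite gt_eqF.
rewrite E in h2 h3; rewrite add0r [leRHS](splitr e).
set S := \sum_(i <- s) _ in h2 h3; set T := torus_int _ in h3 *.
have -> : T - rsum setT (fun i => torus_int (f i)) =
  (-1 * S + T) - (rsum setT (fun i => torus_int (f i)) - S) by ring.
by apply: le_trans (ler_normB _ _) _; exact: lerD.
Qed.

Lemma cos_lipschitz (x y : R) : `|cos x - cos y| <= `|x - y|.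
Proof.
wlog xy : x y / x <= y.
  by move=> H; case/orP: (le_total x y) => /H//; rewrite distrC [leRHS]distrC.
have dc z : z \in `]x, y[ -> is_derive z 1 (@cos R) (- sin z).
  by move=> _; exact: is_derive_cos.
have cc : {within `[x, y], continuous (@cos R)}.
  by apply: continuous_subspaceT; exact: continuous_cos.
have [c _] := MVT_segment xy dc cc.
rewrite distrC [leRHS]distrC => ->; rewrite normrM normrN ler_piMl//.
exact: sin_max.
Qed.

Definition phase d (j : 'rV[int]_d) (x : 'rV[R]_d) : R :=
  \sum_(r < d) (j 0 r)%:~R * x 0 r.

Lemma ucont_cos_phase d (j : 'rV[int]_d) (a : R) : ucont (fun x => cos (a + phase j x)).
Proof.
move=> e e0; pose C : R := 1 + \sum_(r < d) `|(j 0 r)%:~R|.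
have C0 : 0 < C by rewrite ltr_pwDl// sumr_ge0.
exists (e / C); first exact: divr_gt0.
move=> x y xy; apply: le_trans (cos_lipschitz _ _) _.
have -> : a + phase j x - (a + phase j y) = \sum_(r < d) (j 0 r)%:~R * (x 0 r - y 0 r).
  rewrite opprD addrACA subrr add0r -sumrB.
  by apply: eq_bigr => r _; rewrite mulrBr.
apply: le_trans (ler_norm_sum _ _ _) _.
apply: (@le_trans _ _ (\sum_(r < d) `|(j 0 r)%:~R| * (e / C))).
  by apply: ler_sum => r _; rewrite normrM ler_wpM2l// ltW.
rewrite -mulr_suml mulrA ler_pdivrMr// mulrC ler_wpM2l ?ltW//.
by rewrite /C ltrDr.
Qed.

Let sin_shift (x : R) (j : int) : sin (x + j%:~R * (2 * pi)) = sin x.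
Proof.
have N n (y : R) : sin (y + n%:R * (2 * pi)) = sin y.
  by rewrite (mulr_natl pi 2) mulr_natl; exact: (periodicn (@sinD2pi R)).
case: j => n; first exact: N.
rewrite -(N n.+1 (x + _)) NegzE; congr sin.
by rewrite mulrNz mulNr addrNK.
Qed.

Let Rint_cos (a : R) (j : int) :
  \int[mu]_(t in `[0, 2 * pi]) cos (a + j%:~R * t) = if j == 0 then 2 * pi * cos a else 0.
Proof.
have [->|j0] := eqVneq j 0.
  under eq_Rintegral do rewrite mul0r addr0.
  rewrite Rintegral_cst//= lebesgue_measure_itv/= lte_fin pi2_gt0 /=.
  by rewrite subr0 mulrC.
set b : R := j%:~R; have b0 : b != 0 by rewrite intr_eq0.
pose F (t : R) : R := b^-1 * sin (a + b * t).
have dF (t : R) : is_derive t 1 F (cos (a + b * t)).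
  have h : is_derive t 1 (fun t : R => a + b * t) b.
    by apply: is_derive_eq; rewrite add0r mul1r /GRing.scale/= mulr1.
  have hs := @is_derive1_comp R sin (fun t => a + b * t) t _ _ (is_derive_sin (a + b * t)) h.
  have := is_deriveZ b^-1 hs.
  by rewrite /GRing.scale/= (mulrC (cos _)) mulrA mulVf// mul1r.
have cc : continuous (fun t : R => cos (a + b * t)).
  move=> t; apply: continuous_comp; last exact: continuous_cos.
  by apply: cvgD; [exact: cvg_cst|apply: cvgM; [exact: cvg_cst|exact: cvg_id]].
have cF : continuous F.
  move=> t; apply: cvgM; first exact: cvg_cst.
  apply: continuous_comp; last exact: continuous_sin.
  by apply: cvgD; [exact: cvg_cst|apply: cvgM; [exact: cvg_cst|exact: cvg_id]].
rewrite /Rintegral (@continuous_FTC2 R (fun t => cos (a + b * t)) F)//.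
- by rewrite -EFinB /= /F -mulrBr mulr0 addr0 sin_shift subrr mulr0.
- exact: continuous_subspaceT.
- split.
  + by move=> t _; case: (dF t).
  + by apply: cvg_at_right_filter; exact: cF.
  + by apply: cvg_at_left_filter; exact: cF.
- by move=> t _; rewrite derive1E; exact: derive_val.
Qed.

(** Orthogonality of the exponentials. The phase [a] makes the induction on the
    dimension go through, the outer variable being part of the phase of the
    inner integral, and [a = - pi / 2] gives the sines. *)
Lemma torus_int_cos d (j : 'rV[int]_d) (a : R) :
  torus_int (fun x => cos (a + phase j x)) = if j == 0 then (2 * pi) ^+ d * cos a else 0.
Proof.
elim: d j a => [|d IH] j a.
  by rewrite (thinmx0 j) eqxx /= /phase big_ord0 addr0 mul1r.
pose j' : 'rV[int]_d := rsubmx (j : 'rV[int]_(1 + d)).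
have E t (x : 'rV[R]_d) : a + phase j (row_mx t%:M x : 'rV[R]_(1 + d)) =
    (a + (j 0 0)%:~R * t) + phase j' x.
  have E0 : (row_mx t%:M x : 'rV[R]_d.+1) 0 ord0 = t.
    have : (row_mx t%:M x : 'rV[R]_(1 + d)) 0 (lshift d 0) = t.
      by rewrite row_mxEl mxE eqxx mulr1n.
    move=> E0; rewrite -[RHS]E0; congr (fun_of_matrix _ _ _); exact/val_inj.
  have E1 i : (row_mx t%:M x : 'rV[R]_d.+1) 0 (lift ord0 i) = x 0 i.
    rewrite -(row_mxEr (t%:M : 'M[R]_(1, 1)) x).
    by congr (fun_of_matrix _ _ _); exact/val_inj.
  have E2 i : j' 0 i = j 0 (lift ord0 i).
    by rewrite mxE; congr (fun_of_matrix _ _ _); exact/val_inj.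
  rewrite /phase -addrA; congr (_ + _).
  rewrite big_ord_recl E0; congr (_ + _).
  by apply: eq_bigr => i _; rewrite E1 E2.
rewrite /=; under eq_Rintegral => t _.
  under eq_fun do rewrite E; rewrite IH; over.
have jE : (j == 0) = (j' == 0) && (j 0 0 == 0).
  apply/eqP/andP => [j0|[/eqP j'0 /eqP j00]].
    split; last by rewrite j0 mxE.
    by apply/eqP/rowP => i; rewrite !mxE j0 mxE.
  apply/rowP => i; rewrite mxE.
  have := fintype.splitK (i : 'I_(1 + d)); case: (fintype.split _) => k /= <-.
    by rewrite (ord1 k) -[RHS]j00; congr (j _ _); apply/val_inj.
  by move/rowP/(_ k): j'0; rewrite !mxE.
rewrite jE; case: (j' == 0) => /=; last first.
  by rewrite Rintegral_cst//= mul0r.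
rewrite RintegralZl//; last first.
  apply: cont_integrable => t; apply: continuous_comp; last exact: continuous_cos.
  by apply: cvgD; [exact: cvg_cst|apply: cvgM; [exact: cvg_cst|exact: cvg_id]].
by rewrite Rint_cos; case: ifP; rewrite ?mulr0// exprSr mulrA.
Qed.

End TorusIntegral.

(** * Products of Fourier series *)

Section Convolution.
Local Open Scope complex_scope.
Import Normc.
Variables (R : realType) (d : nat).
Implicit Types (k q j : 'rV[int]_d) (v w : fourier R d).

Definition cis (t : R) : R[i] := cos t +i* sin t.

Lemma cisD s t : cis (s + t) = cis s * cis t.
Proof. by apply: complexP; rewrite ?cReM ?cImM /= ?cosD ?sinD//; ring. Qed.

Lemma normc_cis t : normc (cis t) = 1.
Proof. by rewrite /= cos2Dsin2 sqrtr1. Qed.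

Lemma phaseD j k (x : 'rV[R]_d) : phase (j + k) x = phase j x + phase k x.
Proof.
by rewrite /phase -big_split; apply: eq_bigr => r _; rewrite mxE rmorphD mulrDl.
Qed.

Lemma phaseN j (x : 'rV[R]_d) : phase (- j) x = - phase j x.
Proof.
by rewrite /phase -sumrN; apply: eq_bigr => r _; rewrite mxE rmorphN mulNr.
Qed.

Definition basis_const : R := (2 * pi) `^ (- (d%:R / 2)).

Lemma basis_const_gt0 : 0 < basis_const.
Proof. by rewrite powR_gt0// mulr_gt0// pi_gt0. Qed.

(** In the Fourier coefficient of a product of two series the normalization occurs
    three times and the integral contributes [(2 pi)^d], which leaves one factor
    [basis_const]. *)
Lemma sqr_basis_const : (2 * pi) ^+ d * basis_const ^+ 2 = 1.
Proof.
have p0 : 0 < 2 * pi :> R by rewrite mulr_gt0// pi_gt0.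
rewrite -powR_mulrn ?ltW// /basis_const expr2 -!powRD ?(gt_eqF p0) ?implybT//.
by rewrite (_ : _ + (_ + _) = 0) ?powRr0//; lra.
Qed.

Lemma basis_expE k (x : 'rV[R]_d) : basis_exp k x = basis_const%:C * cis (phase k x).
Proof. by []. Qed.

Lemma basis_exp_conj k (x : 'rV[R]_d) :
  (basis_exp k x)^* = basis_const%:C * cis (- phase k x).
Proof. by rewrite basis_expE; apply: complexP => /=; rewrite ?cosN ?sinN; ring. Qed.

Lemma torus_cint_series (I : choiceType) (g : I -> R[i]) (j : I -> 'rV[int]_d) M :
  cbsum g M ->
  torus_cint (fun x => csum setT (fun i => g i * cis (phase (j i) x))) =
  csum setT (fun i => if j i == 0 then ((2 * pi) ^+ d)%:C * g i else 0).
Proof.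
move=> gM.
have trig (a b : R) k : ucont (fun x => a * cos (0 + phase k x) + b * cos (- (pi / 2) + phase k x))
   /\ torus_int (fun x => a * cos (0 + phase k x) + b * cos (- (pi / 2) + phase k x)) =
      if k == 0 then (2 * pi) ^+ d * a else 0.
  split; first by apply: ucontD; apply: ucontZ; exact: ucont_cos_phase.
  rewrite torus_int_lin; last 2 first.
  - exact: ucont_cos_phase.
  - by apply: ucontZ; exact: ucont_cos_phase.
  have := torus_int_lin b (ucont_cos_phase k (- (pi / 2))) (@ucont_cst R d 0).
  under [in X in X -> _]eq_fun do rewrite addr0.
  have -> : torus_int (fun _ : 'rV[R]_d => 0 : R) = 0.
    apply/eqP; rewrite -normr_le0.
    have := torus_int_bound (@ucont_cst R d 0) (M := 0).
    by rewrite mulr0; apply => x; rewrite normr0.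
  rewrite addr0 => ->; rewrite !torus_int_cos.
  case: ifP => _; last by rewrite !mulr0 addr0.
  by rewrite cosN cos_pihalf cos0 !mulr0 addr0 mulr1 mulrC.
have E1 i x : complex.Re (g i * cis (phase (j i) x)) =
    complex.Re (g i) * cos (0 + phase (j i) x) +
    (- complex.Im (g i)) * cos (- (pi / 2) + phase (j i) x).
  by rewrite cReM /= add0r [- (pi / 2) + _]addrC cosBpihalf mulNr.
have E2 i x : complex.Im (g i * cis (phase (j i) x)) =
    complex.Im (g i) * cos (0 + phase (j i) x) +
    (complex.Re (g i)) * cos (- (pi / 2) + phase (j i) x).
  by rewrite cImM /= add0r [- (pi / 2) + _]addrC cosBpihalf addrC.
have bnd i x : normc (g i * cis (phase (j i) x)) <= normc (g i).
  by rewrite normcM normc_cis mulr1.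
apply: complexP => /=.
  rewrite (@torus_int_rsum _ _ _ (fun i x => complex.Re (g i * cis (phase (j i) x)))
    (fun i => normc (g i)) M) //.
  - congr rsum; apply/funext => i; under eq_fun do rewrite E1.
    have [_ ->] := trig (complex.Re (g i)) (- complex.Im (g i)) (j i).
    by case: ifP => // _; rewrite cReM /= mul0r subr0.
  - move=> i; under eq_fun do rewrite E1.
    by have [] := trig (complex.Re (g i)) (- complex.Im (g i)) (j i).
  - by move=> i x; apply: le_trans (ler_Re_normc _) _.
rewrite (@torus_int_rsum _ _ _ (fun i x => complex.Im (g i * cis (phase (j i) x)))
    (fun i => normc (g i)) M) //.
- congr rsum; apply/funext => i; under eq_fun do rewrite E2.
  have [_ ->] := trig (complex.Im (g i)) (complex.Re (g i)) (j i).
  by case: ifP => // _; rewrite cImM /= mul0r addr0.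
- move=> i; under eq_fun do rewrite E2.
  by have [] := trig (complex.Im (g i)) (complex.Re (g i)) (j i).
- by move=> i x; apply: le_trans (ler_Im_normc _) _.
Qed.

Lemma normc_int (z : int) : normc (z%:~R : R[i]) = `|z%:~R|.
Proof. by rewrite int_real_complex normc_real. Qed.

(** The integral of [e_q e_h conj(e_k)] vanishes unless [h = k - q], hence the
    coefficients of the pointwise product are the convolution. *)
Lemma advectE v w Mv Mw k : bsum (fun h => vnorm (v h)) Mv ->
  bsum (fun q => freq_norm R q * vnorm (w q)) Mw ->
  advect v w k = \row_s csum setT (fun q =>
    basis_const%:C * (('i%C * dot (v (k - q)) (cfreq R q)) * w q 0 s)).
Proof.
move=> vM wM; apply/rowP => s; rewrite !mxE.
have vr r : cbsum (fun h => v h 0 r) Mv.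
  by apply: cbsum_le vM => h; rewrite ger0_norm ?vnorm_ge0// normc_le_vnorm.
have wr r : cbsum (fun q => partial r w q 0 s) Mw.
  apply: cbsum_le wM => q; rewrite mxE normcM normcM normci mul1r normc_int.
  rewrite [leRHS]ger0_norm ?mulr_ge0 ?freq_norm_ge0 ?vnorm_ge0//.
  by apply: ler_pM => //; [exact: normc_ge0|exact: ler_freq_norm|exact: normc_le_vnorm].
pose G (i : 'rV[int]_d * 'rV[int]_d) : R[i] :=
  basis_const%:C ^+ 3 * \sum_(r < d) partial r w i.1 0 s * v i.2 0 r.
have GM : cbsum G (normc (basis_const%:C ^+ 3) * \sum_(r < d) (Mw * Mv)).
  by apply: cbsumZ; apply: cbsum_sum => r; exact: (cbsum_prod (wr r) (vr r)).
have Ex x : (\row_s0 \sum_(r < d) torus_fun v x 0 r * torus_fun (partial r w) x 0 s0) 0 s *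
     conjc (basis_exp k x) = csum setT (fun i => G i * cis (phase (i.1 + i.2 - k) x)).
  have bb (f : 'rV[int]_d -> R[i]) M : cbsum f M ->
      cbsum (fun h => f h * basis_exp h x) (M * basis_const).
    move=> fM; have b0 := ltW basis_const_gt0.
    have := bsumZ basis_const fM; rewrite ger0_norm// mulrC; apply: bsum_le => h.
    by rewrite basis_expE !normcM normc_cis mulr1 normc_real (ger0_norm b0) mulrC.
  rewrite basis_exp_conj mxE mulr_suml.
  under eq_bigr => r _.
    rewrite !mxE mulrC (mulrC (csum _ _)) (csum_prod (bb _ _ (wr r)) (bb _ _ (vr r))).
    rewrite -(csumZ _ (cbsum_prod (bb _ _ (wr r)) (bb _ _ (vr r)))); over.
  rewrite -(csum_sum _ (fun r => cbsumZ _ (cbsum_prod (bb _ _ (wr r)) (bb _ _ (vr r))))).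
  congr csum; apply/funext => i; rewrite /G mulr_sumr mulr_suml.
  apply: eq_bigr => r _; rewrite !basis_expE.
  rewrite !phaseD phaseN !cisD /=.
  move: (cis _) (cis _) (cis _) => c1 c2 c3; move: (basis_const%:C) => b.
  move: (partial _ _ _ _ _) (v _ _ _) => p q; ring.
rewrite (_ : (fun x => _) = (fun x => csum setT (fun i => G i * cis (phase (i.1 + i.2 - k) x))));
  last by apply/funext => x; exact: Ex.
rewrite (torus_cint_series _ GM).
(* The double series is summed over [h] first, where only [h = k - q] survives. *)
pose F q h : R[i] := if q + h - k == 0 then ((2 * pi) ^+ d)%:C * G (q, h) else 0.
have FM : cbsum (fun i => F i.1 i.2) (normc ((2 * pi) ^+ d)%:C * 
    (normc (basis_const%:C ^+ 3) * \sum_(r < d) (Mw * Mv))).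
  apply: bsum_le (cbsumZ ((2 * pi) ^+ d)%:C GM) => -[q h]; rewrite /F/=.
  by case: ifP; rewrite ?normc0 ?normr0.
have [_ [_ E]] := csum_pair FM.
have -> : csum setT (fun i => if i.1 + i.2 - k == 0 then ((2 * pi) ^+ d)%:C * G i else 0) =
    csum setT (fun i => F i.1 i.2).
  by congr csum; apply/funext => -[q h].
rewrite -E; congr csum; apply/funext => q.
rewrite (@csum_finsupp _ _ _ [:: k - q])//; last first.
  move=> h; rewrite inE /F => hk; case: eqP => // /subr0_eq qhk.
  by move: hk; rewrite -qhk addrC addKr eqxx.
rewrite big_seq1 /F [q + _]addrC subrK subrr eqxx /G /=.
rewrite mulrA (_ : ((2 * pi) ^+ d)%:C * basis_const%:C ^+ 3 = basis_const%:C); last first.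
  rewrite -rmorphXn -rmorphM/=; congr (_%:C).
  by rewrite (exprS basis_const 2) mulrCA sqr_basis_const mulr1.
congr (_ * _); rewrite /dot mulr_sumr mulr_suml; apply: eq_bigr => r _.
by rewrite !mxE; ring.
Qed.

End Convolution.

(** * Cancellation in the Euler trilinear form *)

Section SymmetrizedForm.
Local Open Scope complex_scope.
Import Normc.
Variables (R : realType) (d : nat).
Implicit Types (k q : 'rV[int]_d) (v w : fourier R d).

Definition freq_weight (p : R) k : R := freq_norm R k `^ (2 * p).

(** The summand of [<P(v,w)|w>_p] at the frequencies [k] and [q], without its
    weight and the normalization of the basis. *)
Definition trilin v w k q : R[i] :=
  conjc ('i%C * dot (v (k - q)) (cfreq R q)) * dot (vconj (w q)) (w k).

Lemma conjcM (x y : R[i]) : conjc (x * y) = conjc x * conjc y.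
Proof. exact: rmorphM. Qed.

Lemma freq_weightN p k : freq_weight p (- k) = freq_weight p k.
Proof. by rewrite /freq_weight freq_normN. Qed.

Lemma freq_weight0 p : p != 0 -> freq_weight p 0 = 0.
Proof. by move=> p0; rewrite /freq_weight freq_norm0 powR0// mulf_neq0. Qed.

Lemma freq_weight_ge0 p k : 0 <= freq_weight p k.
Proof. exact: powR_ge0. Qed.

(** [v_(k-q) . k = v_(k-q) . q] because [v] is solenoidal, and the reality of [w]
    exchanges the two factors of the other scalar product: this is the
    cancellation behind the conservation of energy. *)
Lemma trilin_anti v w k q : (forall j, w j = vconj (w (- j))) ->
  (forall j, dot (cfreq R j) (v j) = 0) ->
  trilin v w (- q) (- k) = - trilin v w k q.
Proof.
move=> wc vo; rewrite /trilin opprK [- q + k]addrC cfreqN dotNr mulrN.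
have -> : dot (v (k - q)) (cfreq R k) = dot (v (k - q)) (cfreq R q).
  by rewrite -{2}(subrK q k) cfreqD dotDr (dotC _ (cfreq R (k - q))) vo add0r.
have -> : w (- q) = vconj (w q) by rewrite (wc q) vconjK.
by rewrite -wc rmorphN mulNr (dotC (w k)).
Qed.

Lemma dot_leray_r (v : fourier R d) (a : 'rV[R[i]]_d) k : k != 0 ->
  dot (cfreq R k) a = 0 -> dot (vconj (leray v k)) a = dot (vconj (v k)) a.
Proof.
move=> k0 ka; rewrite /leray (negbTE k0).
set z := _ / _.
have -> : vconj (v k - z *: cfreq R k) = vconj (v k) - conjc z *: cfreq R k.
  by apply/rowP => r; rewrite !mxE rmorphB rmorphM/= int_real_complex conjc_real.
by rewrite dotC dotDr dotNr dotZr [dot a (cfreq _ _)]dotC ka mulr0 oppr0 addr0 dotC.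
Qed.

(** The zero frequency does not contribute, since the weight vanishes there for
    [p != 0]. *)
Lemma euler_innerE v w (p Mv Mw T : R) : p != 0 ->
  (forall j, dot (cfreq R j) (w j) = 0) ->
  bsum (fun h => vnorm (v h)) Mv -> bsum (fun q => freq_norm R q * vnorm (w q)) Mw ->
  cbsum (fun i => (freq_weight p i.1)%:C * trilin v w i.1 i.2) T ->
  sobolev_inner p (euler_bilin v w) w =
    (basis_const R d)%:C * csum setT (fun i => (freq_weight p i.1)%:C * trilin v w i.1 i.2).
Proof.
move=> p0 wo vM wM tT.
rewrite /sobolev_inner -[X in csum _ X = _](_ : (fun k => (freq_weight p k)%:C *
   dot (vconj (euler_bilin v w k)) (w k)) = _)//.
have E k : k != 0 -> (freq_weight p k)%:C * dot (vconj (euler_bilin v w k)) (w k) =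
    (basis_const R d)%:C * csum setT (fun q => (freq_weight p k)%:C * trilin v w k q).
  move=> k0; rewrite dot_leray_r// (advectE _ vM wM).
  pose X q : R[i] := 'i%C * dot (v (k - q)) (cfreq R q).
  have XM s : cbsum (fun q => (basis_const R d)%:C * (X q * w q 0 s))
      (normc (basis_const R d)%:C * (Mv * Mw)).
    apply: cbsumZ; have := bsumZ Mv wM; rewrite ger0_norm ?(bsum_ge0 vM)//.
    apply: cbsum_le => q; rewrite /X !normcM normci mul1r.
    rewrite [leRHS]ger0_norm ?mulr_ge0 ?freq_norm_ge0 ?vnorm_ge0 ?(bsum_ge0 vM)//.
    rewrite mulrA; apply: ler_pM; rewrite ?normc_ge0 ?normc_le_vnorm//.
    apply: le_trans (normc_dot _ _) _; apply: ler_wpM2r; first exact: freq_norm_ge0.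
    by apply: le_trans (bsum_term (k - q) vM); exact: ler_norm.
  have YM s : cbsum (fun q => conjc ((basis_const R d)%:C * (X q * w q 0 s)))
      (normc (basis_const R d)%:C * (Mv * Mw)).
    by apply: cbsum_le (XM s) => q; rewrite normc_conj ler_norm.
  have -> : dot (vconj (\row_s csum setT (fun q => (basis_const R d)%:C * (X q * w q 0 s)))) (w k) =
     csum setT (fun q => (basis_const R d)%:C * trilin v w k q).
    rewrite /dot; under eq_bigr => s _.
      rewrite !mxE -(csum_conj (XM s)) mulrC -(csumZ _ (YM s)); over.
    rewrite -(csum_sum _ (fun s => cbsumZ _ (YM s))); congr csum; apply/funext => q.
    rewrite /trilin -/(X q) /dot !mulr_sumr; apply: eq_bigr => s _.
    by rewrite mxE !conjcM conjc_real; ring.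
  have [/(_ k) tk _] := csum_pair (F := fun k q => (freq_weight p k)%:C * trilin v w k q) tT.
  have w0 : (freq_weight p k)%:C != 0 :> R[i].
    rewrite -[0]/((0 : R)%:C) (inj_eq (@complexI R)).
    by rewrite gt_eqF// powR_gt0// (lt_le_trans _ (freq_norm_ge1 R k0)).
  have tk' : cbsum (fun q => trilin v w k q) (normc ((freq_weight p k)%:C^-1 : R[i]) * T).
    by apply: cbsum_le (cbsumZ ((freq_weight p k)%:C^-1) tk) => q; rewrite mulKf// ler_norm.
  rewrite -(csumZ _ (cbsumZ _ tk')) -(csumZ _ tk).
  by congr csum; apply/funext => q; rewrite mulrCA.
have Z : (fun k => (freq_weight p k)%:C * dot (vconj (euler_bilin v w k)) (w k)) =
    (fun k => (basis_const R d)%:C * csum setT (fun q => (freq_weight p k)%:C * trilin v w k q)).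
  apply/funext => k; have [->|/E//] := eqVneq k 0.
  rewrite freq_weight0// mul0r (csum_finsupp (s := [::]))// ?big_nil ?mulr0// => q _.
  by rewrite mul0r.
rewrite Z csum_cond; last first.
  move=> k /negP; rewrite negbK => /eqP ->.
  rewrite freq_weight0// (csum_finsupp (s := [::]))// ?big_nil ?mulr0// => q _.
  by rewrite mul0r.
have [_ [tS <-]] := csum_pair (F := fun k q => (freq_weight p k)%:C * trilin v w k q) tT.
by rewrite -(csumZ _ tS).
Qed.

(** The series of [euler_innerE] added to its image under
    [(k, q) -> (- q, - k)]. *)
Lemma euler_inner_sym v w (p Mv Mw T : R) : p != 0 ->
  (forall j, w j = vconj (w (- j))) ->
  (forall j, dot (cfreq R j) (v j) = 0) ->
  (forall j, dot (cfreq R j) (w j) = 0) ->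
  bsum (fun h => vnorm (v h)) Mv -> bsum (fun q => freq_norm R q * vnorm (w q)) Mw ->
  cbsum (fun i => (freq_weight p i.1)%:C * trilin v w i.1 i.2) T ->
  2%:R * sobolev_inner p (euler_bilin v w) w =
    (basis_const R d)%:C *
    csum setT (fun i => (freq_weight p i.1 - freq_weight p i.2)%:C * trilin v w i.1 i.2).
Proof.
move=> p0 wc vo wo vM wM tT; rewrite (euler_innerE p0 wo vM wM tT).
pose F (i : 'rV[int]_d * 'rV[int]_d) : R[i] := (freq_weight p i.1)%:C * trilin v w i.1 i.2.
pose s (i : 'rV[int]_d * 'rV[int]_d) := (- i.2, - i.1).
have sK : cancel s s by move=> [k q]; rewrite /s /= !opprK.
have Fs : cbsum (fun i => F (s i)) T.
  exact: (@bsum_reindex _ _ _ s (fun i => normc (F i)) _ (can_inj sK)).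
rewrite mulrCA; congr (_ * _); rewrite mulrDl mul1r.
rewrite -{2}(csum_reindex sK sK tT) -(csumD tT Fs); congr csum.
apply/funext => -[k q]; rewrite /F /s /= trilin_anti// freq_weightN rmorphB/=.
by rewrite mulrBl mulrN.
Qed.

End SymmetrizedForm.

(** * Convergence of lattice sums *)

Section LatticeSum.
Variable R : realType.

(** From [expR t >= 1 + t] and [ln t <= t - 1]. This elementary form of the mean
    value theorem serves both the convergence of the zeta series and the
    cancellation in the kernel. *)
Lemma powR_ge_lin (x y b : R) : 0 < x -> 0 < y -> 0 <= b ->
  y `^ b * (1 + b * (1 - y / x)) <= x `^ b.
Proof.
move=> x0 y0 b0; have xy0 : 0 < x / y by rewrite divr_gt0.
have -> : x `^ b = y `^ b * (x / y) `^ b.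
  by rewrite -powRM ?ltW// mulrCA divff ?mulr1// gt_eqF.
apply: ler_wpM2l; first exact: powR_ge0.
rewrite /powR gt_eqF//; apply: le_trans (expR_ge1Dx _).
rewrite lerD2l; apply: ler_wpM2l => //.
rewrite -[x / y]invrK lnV; last by rewrite posrE invr_gt0.
rewrite invf_div -[1 - _]opprB lerN2.
have := @le_ln1Dx _ (y / x - 1); rewrite [1 + _]addrC subrK; apply.
by rewrite ltrBrDr addNr divr_gt0.
Qed.

(** With [b = a - 1], the term of index [n] is at most
    [(n^(-b) - (n+1)^(-b)) / b], so that the partial sums telescope. *)
Lemma zeta_bsum (a : R) : 1 < a ->
  exists C, bsum (fun n : nat => n.+1%:R `^ (- a)) C.
Proof.
move=> a1; have [b ab b0] : exists2 b, a = 1 + b & 0 < b.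
  by exists (a - 1); [ring|rewrite subr_gt0].
have partial_sum N : \sum_(0 <= n < N.+1) n.+1%:R `^ (- a) <=
    1 + b^-1 * (1 - N.+1%:R `^ (- b)).
  elim: N => [|N IH]; first by rewrite big_nat1 powR1 subrr mulr0 addr0.
  rewrite big_nat_recr//=; apply: le_trans (lerD IH (lexx _)) _.
  rewrite -addrA lerD2l; set x : R := N.+2%:R; set y : R := N.+1%:R.
  have x0 : 0 < x by rewrite ltr0n.
  have y0 : 0 < y by rewrite ltr0n.
  have xy : x = y + 1 by rewrite /x -natr1.
  have := powR_ge_lin x0 y0 (ltW b0).
  have -> : - a = - b - 1 by rewrite ab; ring.
  rewrite powRD ?(gt_eqF x0) ?implybT// powR_inv1 ?(ltW x0)// !powRN.
  have X0 := powR_gt0 b x0; have Y0 := powR_gt0 b y0.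
  set X := x `^ b in X0 *; set Y := y `^ b in Y0 * => h.
  rewrite -subr_ge0.
  have -> : b^-1 * (1 - X^-1) - (b^-1 * (1 - Y^-1) + X^-1 / x) =
      (X - Y * (1 + b * (1 - y / x))) / (b * X * Y).
    by rewrite xy; field; rewrite ?gt_eqF// -xy.
  by rewrite divr_ge0 ?subr_ge0// !mulr_ge0 ?ltW.
exists (1 + b^-1); apply/bsum_seqP => s us.
pose N := \max_(n <- s) n.
apply: (@le_trans _ _ (\sum_(0 <= n < N.+1) n.+1%:R `^ (- a))); last first.
  apply: le_trans (partial_sum N) _; rewrite lerD2l ler_piMr//; first by rewrite invr_ge0 ltW.
rewrite (eq_bigr (fun n => n.+1%:R `^ (- a))); last first.
  by move=> n _; rewrite ger0_norm ?powR_ge0.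
rewrite [leRHS](bigID (mem s))/= -[leLHS]addr0 lerD//; last first.
  by apply: sumr_ge0 => n _; exact: powR_ge0.
rewrite -[leRHS]big_filter le_eqVlt; apply/orP; left; apply/eqP/perm_big.
apply: uniq_perm; rewrite ?filter_uniq ?iota_uniq// => n.
rewrite mem_filter mem_index_iota /=; apply/idP/andP => [ns|[//]].
by split=> //; rewrite ltnS /N (big_rem n)//= leq_maxl.
Qed.

Lemma zeta_int_bsum (a : R) : 1 < a ->
  exists C, bsum (fun z : int => (1 + `|z%:~R|) `^ (- a)) C.
Proof.
move=> a1; have [C hC] := zeta_bsum a1; exists (C + C).
pose e (z : int) : bool * nat := match z with Posz n => (true, n) | Negz n => (false, n) end.
have ie : injective e by move=> [m|m] [n|n] //= [->].
have F : bsum (fun k : bool * nat => k.2.+1%:R `^ (- a)) (C + C).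
  apply: (@bsum_pair _ bool nat (fun _ n => n.+1%:R `^ (- a)) (fun=> C)) => //.
  apply/bsum_seqP => s us.
  have C0 := bsum_ge0 hC.
  apply: (@le_trans _ _ (\sum_(i <- [:: true; false]) `|C|)); last first.
    by rewrite !big_cons big_nil ger0_norm// addr0.
  rewrite !big_const_seq !iter_addr_0 ler_wpMn2l// !count_predT.
  by apply: uniq_leq_size => // -[].
apply: bsum_le (bsum_reindex ie F) => z.
rewrite [leLHS]ger0_norm ?powR_ge0// [leRHS]ger0_norm ?powR_ge0// !powRN lef_pV2 ?posrE ?powR_gt0 ?ltr_pwDl//.
apply: ge0_ler_powR; rewrite ?nnegrE ?addr_ge0//; first by lra.
case: z => n /=; first by rewrite normr_nat -natr1 addrC.
rewrite NegzE mulrNz normrN normr_nat.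
by rewrite lerDr.
Qed.

(** A series of products over independent coordinates is a product of series. *)
Lemma lattice_prod_bsum (d : nat) (a : R) : 1 < a ->
  exists C, bsum (fun k : 'rV[int]_d => \prod_(r < d) (1 + `|(k 0 r)%:~R|) `^ (- a)) C.
Proof.
move=> a1; have [C hC] := zeta_int_bsum a1; elim: d => [|d [D hD]].
  exists 1; apply/bsum_seqP => s us.
  apply: (@le_trans _ _ (\sum_(i <- [:: (0 : 'rV[int]_0)]) 1)); last by rewrite big_seq1.
  under eq_bigr do rewrite big_ord0 normr1.
  rewrite !big_const_seq !iter_addr_0 ler_wpMn2l// !count_predT.
  by apply: uniq_leq_size => // k _; rewrite inE (thinmx0 k).
exists (D * C).
pose e (k : 'rV[int]_d.+1) : int * 'rV[int]_d := (k 0 0, rsubmx (k : 'rV[int]_(1 + d))).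
have E2 (k : 'rV[int]_d.+1) i : (e k).2 0 i = k 0 (lift ord0 i).
  by rewrite mxE; congr (fun_of_matrix _ _ _); exact/val_inj.
have ie : injective e.
  move=> k q ekq; apply/rowP => i; have [j ->|->] := unliftP ord0 i.
    by rewrite -!E2 ekq.
  by case: ekq.
pose F (z : int) (k : 'rV[int]_d) : R := (1 + `|z%:~R|) `^ (- a) *
   \prod_(r < d) (1 + `|(k 0 r)%:~R|) `^ (- a).
have FM : bsum (fun i => F i.1 i.2) (D * C).
  apply: (@bsum_pair _ _ _ F (fun z => D * (1 + `|z%:~R|) `^ (- a))).
    move=> z; have := bsumZ ((1 + `|z%:~R|) `^ (- a)) hD.
    by rewrite (ger0_norm (powR_ge0 _ _)) mulrC.
  by have := bsumZ D hC; rewrite (ger0_norm (bsum_ge0 hD)).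
apply: bsum_le (bsum_reindex ie FM) => k.
rewrite /F big_ord_recl; under [in leRHS]eq_bigr do rewrite E2.
exact: lexx.
Qed.

(** Every coordinate satisfies [1 + |k_r| <= 2 |k|] for [k != 0], so that
    [|k|^(-s)] is bounded by a product over the coordinates of the powers
    [-s/d < -1]. *)
Lemma lattice_bsum (d : nat) (s : R) : (0 < d)%N -> d%:R < s ->
  exists2 S : R, 0 <= S &
    bsum (fun k : 'rV[int]_d => if k == 0 then 0 else freq_norm R k `^ (- s)) (S ^+ 2).
Proof.
move=> d0 ds; have dR : 0 < d%:R :> R by rewrite ltr0n.
pose a := s / d%:R; have a1 : 1 < a by rewrite ltr_pdivlMr// mul1r.
have a0 : 0 <= a by lra.
have [C hC] := lattice_prod_bsum d a1.
pose K : R := 2 `^ s * C.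
have K0 : 0 <= K by rewrite mulr_ge0 ?powR_ge0 ?(bsum_ge0 hC).
exists (Num.sqrt K); rewrite ?sqrtr_ge0// sqr_sqrtr//.
have := bsumZ (2 `^ s) hC; rewrite ger0_norm ?powR_ge0// -/K; apply: bsum_le => k.
rewrite [leRHS]ger0_norm; last first.
  by rewrite mulr_ge0 ?powR_ge0 ?prodr_ge0// => r _; exact: powR_ge0.
have [_|k0] := eqVneq k 0.
  by rewrite normr0 mulr_ge0 ?powR_ge0 ?prodr_ge0// => r _; exact: powR_ge0.
rewrite ger0_norm ?powR_ge0//.
have n1 := freq_norm_ge1 R k0.
have -> : freq_norm R k `^ (- s) = 2 `^ s * (2 * freq_norm R k) `^ (- s).
  rewrite powRM//; last by lra.
  by rewrite mulrA -powRD ?subrr ?powRr0 ?mul1r// pnatr_eq0 implybT.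
apply: ler_wpM2l; first exact: powR_ge0.
have -> : - s = - a * d%:R by rewrite /a mulNr divfK// gt_eqF.
rewrite powRrM powR_mulrn ?powR_ge0// //.
rewrite (_ : _ ^+ d = \prod_(r < d) (2 * freq_norm R k) `^ (- a)); last first.
  by rewrite prodr_const card_ord.
apply: ler_prod => r _; rewrite powR_ge0/= !powRN lef_pV2 ?posrE ?powR_gt0 ?ltr_pwDl//.
  by apply: ge0_ler_powR; rewrite ?nnegrE ?addr_ge0//; have := ler_freq_norm R k r; lra.
by lra.
Qed.

End LatticeSum.

(** * Sobolev norms *)

Section SobolevSpaces.
Variables (R : realType) (d : nat).
Implicit Types (v w : fourier R d) (m : R).

Definition sobolev_term m v k : R := freq_norm R k `^ (2 * m) * vnorm (v k) ^+ 2.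

Lemma sobolev_term_ge0 m v k : 0 <= sobolev_term m v k.
Proof. by rewrite mulr_ge0 ?powR_ge0 ?sqr_ge0. Qed.

Lemma sobolev_term_sqr m v k : sobolev_term m v k = (freq_norm R k `^ m * vnorm (v k)) ^+ 2.
Proof. by rewrite exprMn -powR_mulrn ?powR_ge0// -powRrM (mulrC m). Qed.

Lemma sobolev_norm_ge0 m v : 0 <= sobolev_norm m v.
Proof. exact: sqrtr_ge0. Qed.

Lemma sqr_sobolev_norm m v M : v 0 = 0 -> bsum (sobolev_term m v) M ->
  sobolev_norm m v ^+ 2 = rsum setT (sobolev_term m v).
Proof.
move=> v0 vM.
have E : complex.Re (sobolev_inner m v v) = rsum setT (sobolev_term m v).
  rewrite /sobolev_inner /csum /= -(@rsum_cond _ _ (@nonzero_freq d)); last first.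
    by move=> k /negP; rewrite negbK => /eqP ->; rewrite /sobolev_term v0 vnorm0 expr0n mulr0.
  congr rsum; apply/funext => k; rewrite /sobolev_term sqr_vnormE /freq_norm.
  by case: (dot _ _) => x y /=; rewrite mul0r subr0.
rewrite sqr_sqrtr E//; apply: bsum_ge0.
exact: rsum_ge0_bsum (sobolev_term_ge0 m v) vM.
Qed.

Lemma sobolev_bsum m v : sobolev m v -> bsum (sobolev_term m v) (sobolev_norm m v ^+ 2).
Proof.
move=> [_ _ v0 fin].
have E : (\esum_(k in @nonzero_freq d) (sobolev_term m v k)%:E =
    \esum_(k in setT) (sobolev_term m v k)%:E)%E.
  rewrite esum_mkcond; apply: eq_esum => k _; case: ifPn => // /negP.
  rewrite inE => /negP; rewrite negbK => /eqP ->.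
  by rewrite /sobolev_term v0 vnorm0 expr0n mulr0.
rewrite [X in (X < _)%E]E in fin.
have sM : bsum (sobolev_term m v) (fine (\esum_(k in setT) (sobolev_term m v k)%:E)%E).
  apply/esum_bsum; first exact: sobolev_term_ge0.
  rewrite fineK// ge0_fin_numE//; apply: esum_ge0 => k _.
  by rewrite lee_fin sobolev_term_ge0.
rewrite (sqr_sobolev_norm v0 sM); exact: rsum_ge0_bsum (sobolev_term_ge0 m v) sM.
Qed.

Lemma sobolev_le m m' v : m <= m' -> sobolev m' v -> sobolev m v.
Proof.
move=> mm' [v1 v2 v3 v4]; split=> //; apply: le_lt_trans v4.
apply: le_esum => k k0; rewrite lee_fin ler_wpM2r ?sqr_ge0//.
by apply: ler_powR; [exact: freq_norm_ge1|rewrite ler_wpM2l].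
Qed.

(** Cauchy-Schwarz with the weights [|k|^(1-n)], which are square summable exactly
    when [2 (n - 1) > d]. *)
Lemma sobolev_l1 (n : R) : (0 < d)%N -> d%:R / 2 + 1 < n -> exists2 S : R, 0 < S &
  forall v, sobolev n v -> bsum (fun k => freq_norm R k * vnorm (v k)) (S * sobolev_norm n v).
Proof.
move=> d0 dn; have [|S S0 hS] := @lattice_bsum R d (2 * (n - 1)) d0; first by lra.
exists (S + 1); first by lra.
move=> v vn; have [_ _ v0 _] := vn.
pose f (k : 'rV[int]_d) : R := if k == 0 then 0 else freq_norm R k `^ (1 - n).
have hf : bsum (fun k : 'rV[int]_d => f k ^+ 2) (S ^+ 2).
  apply: bsum_le hS => k; rewrite /f; case: ifP => _; first by rewrite expr0n.
  rewrite -powR_mulrn ?powR_ge0// -powRrM.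
  by rewrite (_ : (1 - n) * _ = - (2 * (n - 1))); [exact: lexx|ring].
have hv : bsum (fun k => (freq_norm R k `^ n * vnorm (v k)) ^+ 2) (sobolev_norm n v ^+ 2).
  by apply: bsum_le (sobolev_bsum vn) => k; rewrite sobolev_term_sqr.
apply: (@bsum_widen _ _ _ (S * sobolev_norm n v)).
  by apply: ler_wpM2r; [exact: sobolev_norm_ge0|lra].
apply: bsum_le (bsum_CS S0 (sobolev_norm_ge0 n v) hf hv) => k; rewrite /f.
have [->|k0] := eqVneq k 0; first by rewrite freq_norm0 !mul0r.
have n0 : freq_norm R k != 0 by rewrite gt_eqF// (lt_le_trans _ (freq_norm_ge1 R k0)).
rewrite mulrA -powRD ?n0 ?implybT// subrK powRr1//; exact: freq_norm_ge0.
Qed.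

End SobolevSpaces.

(** * Young inequalities for sequences *)

Section Young.
Variables (R : realType) (d : nat).
Implicit Types a b c : 'rV[int]_d -> R.

Let bsum_sub b B k : bsum (fun q => b q ^+ 2) B -> bsum (fun q => b (k - q) ^+ 2) B.
Proof. by apply: (@bsum_reindex _ _ _ (fun q => k - q)) => x y /addrI/oppr_inj. Qed.

Let bsum_rsub b B k : bsum (fun q => b q ^+ 2) B -> bsum (fun q => b (q - k) ^+ 2) B.
Proof. by apply: (@bsum_reindex _ _ _ (fun q => q - k)) => x y /addIr. Qed.

(** In this lemma and the next two, the summation over the index of the summable
    factor is performed last, and Cauchy-Schwarz bounds the inner sum uniformly. *)
Lemma young_l1_right a b c A B C : 0 <= A -> 0 <= B ->
  bsum (fun k => a k ^+ 2) (A ^+ 2) -> bsum (fun k => b k ^+ 2) (B ^+ 2) -> bsum c C ->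
  bsum (fun i => a i.1 * b (i.1 - i.2) * c i.2) (A * B * C).
Proof.
move=> A0 B0 hA hB hC.
pose F q k := c q * (a k * b (k - q)).
have FM : bsum (fun i => F i.1 i.2) (A * B * C).
  apply: (@bsum_pair _ _ _ F (fun q => A * B * `|c q|)).
    by move=> q; rewrite [A * B * _]mulrC; apply: (@bsumZ _ _ (fun k => a k * b (k - q))); apply: bsum_CS (bsum_rsub _ hB).
  have h : bsum (fun q => `|c q|) C by apply: bsum_le hC => q; rewrite normr_id.
  by have := bsumZ (A * B) h; rewrite (ger0_norm (mulr_ge0 _ _)).
apply: bsum_le (@bsum_reindex _ _ _ (fun i => (i.2, i.1)) _ _ _ FM).
  by move=> [k q]; rewrite /F/= mulrC.
by move=> [k q] [k' q'] /= [-> ->].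
Qed.

Lemma young_l1_mid a b c A B C : 0 <= A -> 0 <= C ->
  bsum (fun k => a k ^+ 2) (A ^+ 2) -> bsum b B -> bsum (fun k => c k ^+ 2) (C ^+ 2) ->
  bsum (fun i => a i.1 * b (i.1 - i.2) * c i.2) (A * B * C).
Proof.
move=> A0 C0 hA hB hC.
pose F h k := b h * (a k * c (k - h)).
have FM : bsum (fun i => F i.1 i.2) (A * B * C).
  rewrite mulrAC; apply: (@bsum_pair _ _ _ F (fun h => A * C * `|b h|)).
    by move=> q; rewrite [A * C * _]mulrC; apply: (@bsumZ _ _ (fun k => a k * c (k - q))); apply: bsum_CS (bsum_rsub _ hC).
  have h : bsum (fun q => `|b q|) B by apply: bsum_le hB => q; rewrite normr_id.
  by have := bsumZ (A * C) h; rewrite (ger0_norm (mulr_ge0 _ _)).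
apply: bsum_le (@bsum_reindex _ _ _ (fun i => (i.1 - i.2, i.1)) _ _ _ FM).
  by move=> [k q]; rewrite /F/= subKr mulrCA mulrA.
by move=> [k q] [k' q'] /= [E kk']; move: E; rewrite kk' => /addrI/oppr_inj ->.
Qed.

Lemma young_l1_left a b c A B C : 0 <= B -> 0 <= C ->
  bsum a A -> bsum (fun k => b k ^+ 2) (B ^+ 2) -> bsum (fun k => c k ^+ 2) (C ^+ 2) ->
  bsum (fun i => a i.1 * b (i.1 - i.2) * c i.2) (A * B * C).
Proof.
move=> B0 C0 hA hB hC.
pose F k q := a k * (b (k - q) * c q).
have FM : bsum (fun i => F i.1 i.2) (A * B * C).
  rewrite -mulrA mulrC; apply: (@bsum_pair _ _ _ F (fun k => B * C * `|a k|)).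
    by move=> k; rewrite [B * C * _]mulrC; apply: (@bsumZ _ _ (fun q => b (k - q) * c q)); apply: bsum_CS (bsum_sub _ hB) _.
  have h : bsum (fun q => `|a q|) A by apply: bsum_le hA => q; rewrite normr_id.
  by have := bsumZ (B * C) h; rewrite (ger0_norm (mulr_ge0 _ _)).
by apply: bsum_le FM => -[k q]; rewrite /F/= mulrA.
Qed.

End Young.

(** * Upper bound for the Kato constant *)

Section UpperBound.
Local Open Scope complex_scope.
Import Normc.
Variables (R : realType) (d : nat).
Implicit Types (v w : fourier R d) (k q : 'rV[int]_d).

Lemma powR_add_le (a y p : R) : 0 <= a -> 0 <= y -> 0 <= p ->
  (a + y) `^ p <= 2 `^ p * (a `^ p + y `^ p).
Proof.
move=> a0 y0 p0.
have H (s t : R) : 0 <= s -> s <= t -> (s + t) `^ p <= 2 `^ p * t `^ p.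
  move=> s0 st; rewrite -powRM//; last by apply: le_trans st.
  by apply: ge0_ler_powR; rewrite ?nnegrE//; lra.
have [ay|/ltW ya] := leP a y.
  apply: le_trans (H _ _ a0 ay) _; apply: ler_wpM2l; first exact: powR_ge0.
  by rewrite lerDr powR_ge0.
rewrite addrC; apply: le_trans (H _ _ y0 ya) _; apply: ler_wpM2l; first exact: powR_ge0.
by rewrite lerDl powR_ge0.
Qed.

(** This is the kernel that is left after the cancellation. For [m <= a] the
    difference of powers may be replaced by [M^p]; for [a <= m] it gains the
    factor [a / m], which spares one derivative. In both cases [M] is at most
    twice the larger of [a] and [m]. *)
Lemma powR_diff_le (M m a p : R) : 0 <= m -> m <= M -> M <= m + a -> 1 <= p ->
  (M `^ p - m `^ p) * m <= p * 2 `^ p * (a `^ p * m + a * m `^ p).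
Proof.
move=> m0 mM Ma p1; have p0 : 0 <= p by lra.
have a0 : 0 <= a by lra.
have Mp : 0 <= M by lra.
have am0 : 0 <= a `^ p * m by rewrite mulr_ge0 ?powR_ge0.
have am1 : 0 <= a * m `^ p by rewrite mulr_ge0 ?powR_ge0.
have t0 : 0 <= 2 `^ p :> R by exact: powR_ge0.
have M2 (t : R) : m <= t -> a <= t -> M `^ p <= 2 `^ p * t `^ p.
  move=> mt at_; rewrite -powRM//; last by lra.
  by apply: ge0_ler_powR; rewrite ?nnegrE; lra.
have [ma|/ltW am] := leP m a.
  apply: (@le_trans _ _ (M `^ p * m)).
    by rewrite ler_wpM2r// gerBl powR_ge0.
  apply: (@le_trans _ _ (2 `^ p * (a `^ p * m))).
    by rewrite mulrA ler_wpM2r// M2.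
  rewrite -mulrA; apply: (@le_trans _ _ (2 `^ p * (a `^ p * m + a * m `^ p))).
    by rewrite ler_wpM2l// lerDl.
  by rewrite ler_peMl// mulr_ge0// addr_ge0.
have [->|mn0] := eqVneq m 0; first by rewrite !mulr0 mulr_ge0// ?mulr_ge0// add0r mulr_ge0// powR_ge0.
have mp : 0 < m by rewrite lt_neqAle eq_sym mn0.
have MP : 0 < M by lra.
have h := powR_ge_lin mp MP p0.
have MMp := powR_ge0 M p.
apply: (@le_trans _ _ (p * M `^ p * (M - m))).
  have : M `^ p * (1 + p * (1 - M / m)) * m <= m `^ p * m by rewrite ler_wpM2r.
  have -> : M `^ p * (1 + p * (1 - M / m)) * m = M `^ p * m - p * M `^ p * (M - m).
    by field.
  by rewrite mulrBl; lra.
rewrite -!mulrA ler_wpM2l//.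
apply: (@le_trans _ _ (2 `^ p * (a * m `^ p))); last by rewrite ler_wpM2l// lerDr.
rewrite [a * _]mulrC mulrA; apply: ler_pM => //; [lra|exact: M2|lra].
Qed.

(** The minimum is available because [v_(k-q)] has the same scalar product with
    [k] and with [q]. *)
Lemma trilin_le v w k q : (forall j, dot (cfreq R j) (v j) = 0) ->
  normc (trilin v w k q) <=
    vnorm (v (k - q)) * Num.min (freq_norm R k) (freq_norm R q) * (vnorm (w k) * vnorm (w q)).
Proof.
move=> vo; rewrite /trilin normcM normc_conj normcM normci mul1r.
apply: ler_pM; rewrite ?normc_ge0//; last first.
  by apply: le_trans (normc_dot _ _) _; rewrite vnorm_vconj mulrC.
have E : dot (v (k - q)) (cfreq R k) = dot (v (k - q)) (cfreq R q).
  by rewrite -{2}(subrK q k) cfreqD dotDr (dotC _ (cfreq R (k - q))) vo add0r.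
by rewrite /Num.min; case: ifP => _; first rewrite -E; exact: normc_dot.
Qed.

Lemma freq_weightE p k : freq_weight p k = freq_norm R k `^ p * freq_norm R k `^ p.
Proof. by rewrite /freq_weight mulrC powRrM powR_mulrn ?powR_ge0// expr2. Qed.

Let sqr_diff_le (X Y A x y a K : R) : 0 <= Y -> Y <= X -> 0 <= A -> 0 <= a -> 0 <= K ->
  y <= x -> (X - Y) * y <= K * (A * y + a * Y) ->
  `|X * X - Y * Y| * y <= K * (X * (A * y + a * Y) + Y * (A * x + a * X)).
Proof.
move=> Y0 YX A0 a0 K0 yx h.
have X0 : 0 <= X by exact: le_trans YX.
have -> : X * X - Y * Y = (X + Y) * (X - Y) by ring.
have P0 : 0 <= (X + Y) * (X - Y).
  by apply: mulr_ge0; [exact: addr_ge0|rewrite subr_ge0].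
rewrite (ger0_norm P0).
have -> : (X + Y) * (X - Y) * y = X * ((X - Y) * y) + Y * ((X - Y) * y) by ring.
rewrite [leRHS]mulrDr; apply: lerD.
  by rewrite [leRHS]mulrCA ler_wpM2l.
rewrite [leRHS]mulrCA ler_wpM2l//; apply: le_trans h _.
by rewrite ler_wpM2l// lerD// ler_wpM2l.
Qed.

Lemma freq_weight_diff_le (p : R) k q : 1 <= p ->
  `|freq_weight p k - freq_weight p q| * Num.min (freq_norm R k) (freq_norm R q) <=
  p * 2 `^ p * (freq_norm R k `^ p * (freq_norm R (k - q) `^ p * freq_norm R q + freq_norm R (k - q) * freq_norm R q `^ p)
              + freq_norm R q `^ p * (freq_norm R (k - q) `^ p * freq_norm R k + freq_norm R (k - q) * freq_norm R k `^ p)).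
Proof.
move=> p1; have p0 : 0 <= p by lra.
have K0 : 0 <= p * 2 `^ p by rewrite mulr_ge0 ?powR_ge0.
wlog kq : k q / freq_norm R q <= freq_norm R k.
  move=> H; case/orP: (le_total (freq_norm R q) (freq_norm R k)) => h; first exact: H.
  rewrite distrC minC -(opprB q k) freq_normN [X in _ <= _ * X]addrC; exact: H.
rewrite (min_idPr kq) !freq_weightE.
apply: (sqr_diff_le (powR_ge0 _ _) _ (powR_ge0 _ _) (freq_norm_ge0 R _) K0 kq).
  by apply: ge0_ler_powR; rewrite ?nnegrE ?freq_norm_ge0.
apply: powR_diff_le; rewrite ?freq_norm_ge0//.
by rewrite addrC -{1}(subrK q k) freq_normD.
Qed.

Let powR_succ (x p : R) : 0 <= x -> 0 <= p -> x `^ (p + 1) = x `^ p * x.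
Proof.
move=> x0 p0; rewrite powRD ?powRr1//.
have p1 : p + 1 != 0 by rewrite gt_eqF//; lra.
by rewrite (negbTE p1).
Qed.

Let weight_split_le (X P A Y m y a b c : R) : 0 <= X -> 0 <= y ->
  0 <= a -> 0 <= b -> 0 <= c -> X <= P * (A + Y) -> m <= y ->
  X * X * (c * m * (b * a)) <= P * (X * b * (A * c) * (y * a) + X * b * c * (Y * y * a)).
Proof.
move=> X0 y0 a0 b0 c0 XP my.
apply: (@le_trans _ _ (X * X * (c * y * (b * a)))).
  by rewrite ler_wpM2l ?mulr_ge0// ler_wpM2r ?mulr_ge0// ler_wpM2l.
have -> : P * (X * b * (A * c) * (y * a) + X * b * c * (Y * y * a)) =
  P * (A + Y) * (X * (c * y * (b * a))) by ring.
by rewrite -mulrA ler_wpM2r// !mulr_ge0.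
Qed.

Let kernel_expand (P X Y A a x y c b e : R) :
  P * (X * (A * y + a * Y) + Y * (A * x + a * X)) * (c * (b * e)) =
  P * (X * b * (A * c) * (y * e) + X * b * (a * c) * (Y * e) +
       (x * b * (A * c) * (Y * e) + X * b * (a * c) * (Y * e))).
Proof. ring. Qed.

Section Estimate.
Variables (n p S : R) (v w : fourier R d).
Hypotheses (p1 : 1 <= p) (np : n <= p).
Hypothesis hS : forall u : fourier R d, sobolev n u ->
  bsum (fun k => freq_norm R k * vnorm (u k)) (S * sobolev_norm n u).
Hypotheses (vp : sobolev p v) (wp1 : sobolev (p + 1) w).

Let p0 : 0 <= p. Proof. exact: le_trans ler01 p1. Qed.
Let p_neq0 : p != 0. Proof. by rewrite gt_eqF// (lt_le_trans ltr01 p1). Qed.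
Let wp : sobolev p w. Proof. by apply: sobolev_le wp1; lra. Qed.
Let V := sobolev_norm p v.
Let Vn := sobolev_norm n v.
Let W := sobolev_norm p w.
Let Wn := sobolev_norm n w.
Let V0 : 0 <= V. Proof. exact: sobolev_norm_ge0. Qed.
Let W0 : 0 <= W. Proof. exact: sobolev_norm_ge0. Qed.

Let l2 m (u : fourier R d) : sobolev m u ->
  bsum (fun k => (freq_norm R k `^ m * vnorm (u k)) ^+ 2) (sobolev_norm m u ^+ 2).
Proof. by move=> um; apply: bsum_le (sobolev_bsum um) => k; rewrite sobolev_term_sqr. Qed.

Let l1 (u : fourier R d) : sobolev p u ->
  bsum (fun k => freq_norm R k * vnorm (u k)) (S * sobolev_norm n u).
Proof. by move=> up; apply: hS; apply: sobolev_le up. Qed.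

Let l1' : bsum (fun k => vnorm (v k)) (S * Vn).
Proof.
apply: bsum_le (l1 vp) => k; have [_ _ v0 _] := vp.
rewrite !ger0_norm ?mulr_ge0 ?freq_norm_ge0 ?vnorm_ge0//.
have [->|k0] := eqVneq k 0; first by rewrite v0 vnorm0 mulr0.
by rewrite ler_peMl ?vnorm_ge0 ?freq_norm_ge1.
Qed.

(** The series before symmetrization is absolutely convergent because [w] is of
    order [p + 1], one derivative more than appears in the final estimate. *)
Lemma weighted_trilin_bsum : exists T,
  cbsum (fun i : 'rV[int]_d * 'rV[int]_d => (freq_weight p i.1)%:C * trilin v w i.1 i.2) T.
Proof.
have [_ vo _ _] := vp.
have T1 := young_l1_right W0 V0 (l2 wp) (l2 vp) (l1 wp).
have T2 := young_l1_mid W0 (sobolev_norm_ge0 _ _) (l2 wp) l1' (l2 wp1).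
eexists; apply: cbsum_le (bsumZ (2 `^ p) (bsumD T1 T2)) => -[k q] /=.
rewrite [leRHS]ger0_norm; last first.
  by rewrite !(mulr_ge0, addr_ge0) ?powR_ge0 ?freq_norm_ge0 ?vnorm_ge0.
rewrite normcM normc_real ger0_norm ?freq_weight_ge0//.
apply: le_trans (ler_wpM2l (freq_weight_ge0 _ _) (trilin_le w k q vo)) _.
have mq : Num.min (freq_norm R k) (freq_norm R q) <= freq_norm R q by rewrite ge_min lexx orbT.
have E : freq_norm R k `^ p <= 2 `^ p * (freq_norm R (k - q) `^ p + freq_norm R q `^ p).
  apply: le_trans (powR_add_le _ _ _); rewrite ?freq_norm_ge0//.
  apply: ge0_ler_powR; rewrite ?nnegrE ?addr_ge0 ?freq_norm_ge0//.
  by rewrite -{1}(subrK q k) freq_normD.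
have F : freq_norm R q `^ (p + 1) = freq_norm R q `^ p * freq_norm R q.
  exact: powR_succ (freq_norm_ge0 R q) p0.
rewrite freq_weightE F.
apply: weight_split_le E mq; rewrite ?powR_ge0 ?freq_norm_ge0 ?vnorm_ge0//.
Qed.

(** The four products of [freq_weight_diff_le] are summed by the three Young
    inequalities; the factor that carries a frequency norm to the
    first power is the summable one. *)
Lemma sym_trilin_cbsum :
  cbsum (fun i : 'rV[int]_d * 'rV[int]_d =>
      (freq_weight p i.1 - freq_weight p i.2)%:C * trilin v w i.1 i.2)
    (p * 2 `^ p * (2 * S * W * (V * Wn + Vn * W))).
Proof.
have [_ vo _ _] := vp.
have T1 := young_l1_right W0 V0 (l2 wp) (l2 vp) (l1 wp).
have T2 := young_l1_mid W0 W0 (l2 wp) (l1 vp) (l2 wp).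
have T3 := young_l1_left V0 W0 (l1 wp) (l2 vp) (l2 wp).
have K0 : 0 <= p * 2 `^ p by rewrite mulr_ge0 ?powR_ge0.
have h := bsumZ (p * 2 `^ p) (bsumD (bsumD T1 T2) (bsumD T3 T2)).
rewrite (ger0_norm K0) in h.
have -> : 2 * S * W * (V * Wn + Vn * W) = W * V * (S * Wn) + W * (S * Vn) * W +
  (S * Wn * V * W + W * (S * Vn) * W) by ring.
apply: cbsum_le h => -[k q] /=.
rewrite [leRHS]ger0_norm; last first.
  by rewrite !(mulr_ge0, addr_ge0) ?powR_ge0 ?freq_norm_ge0 ?vnorm_ge0.
rewrite normcM normc_real.
apply: le_trans (ler_wpM2l (normr_ge0 _) (trilin_le w k q vo)) _.
have hk := freq_weight_diff_le k q p1.
set c := vnorm (v _); set m := Num.min _ _ in hk *.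
have -> : `|freq_weight p k - freq_weight p q| * (c * m * (vnorm (w k) * vnorm (w q))) =
   (`|freq_weight p k - freq_weight p q| * m) * (c * (vnorm (w k) * vnorm (w q))) by ring.
apply: le_trans (ler_wpM2r _ hk) _; first by rewrite !mulr_ge0 ?vnorm_ge0.
by rewrite kernel_expand.
Qed.

Lemma euler_sym_identity : 2%:R * sobolev_inner p (euler_bilin v w) w =
    (basis_const R d)%:C *
    csum setT (fun i => (freq_weight p i.1 - freq_weight p i.2)%:C * trilin v w i.1 i.2).
Proof.
have [_ vo _ _] := vp; have [wc wo _ _] := wp.
have [T hT] := weighted_trilin_bsum.
exact: (euler_inner_sym p_neq0 wc vo wo l1' (l1 wp) hT).
Qed.

Lemma euler_inner_le : complex.Re `|sobolev_inner p (euler_bilin v w) w| <=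
  2^-1 * (4 * basis_const R d * S * p * 2 `^ p) * (V * Wn + Vn * W) * W.
Proof.
rewrite normcE; have b0 := basis_const_gt0 R d.
have : normc (2%:R * sobolev_inner p (euler_bilin v w) w) <=
    basis_const R d * (2 * (p * 2 `^ p * (2 * S * W * (V * Wn + Vn * W)))).
  rewrite euler_sym_identity normcM normc_real (ger0_norm (ltW b0)).
  by apply: (ler_wpM2l (ltW b0)); exact: normc_csum sym_trilin_cbsum.
have -> : (2%:R : R[i]) = (2%:R : R)%:C by rewrite rmorph_nat.
rewrite normcM normc_real ger0_norm// => h.
have -> : 2^-1 * (4 * basis_const R d * S * p * 2 `^ p) * (V * Wn + Vn * W) * W =
  2^-1 * (basis_const R d * (2 * (p * 2 `^ p * (2 * S * W * (V * Wn + Vn * W))))) by field.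
by rewrite ler_pdivlMl.
Qed.

End Estimate.

Lemma kato_upper (n : R) : (0 < d)%N -> d%:R / 2 + 1 < n ->
  exists2 C : R, 0 < C & forall p, n <= p -> kato_bound d p n (C * p * 2 `^ p).
Proof.
move=> d0 dn; have [S S0 hS] := sobolev_l1 d0 dn.
exists (4 * basis_const R d * S); first by rewrite !mulr_gt0 ?basis_const_gt0.
move=> p np v w vp wp.
have dp : 0 <= d%:R / 2 :> R by rewrite divr_ge0.
by apply: (@euler_inner_le n p S v w) => //; lra.
Qed.

End UpperBound.

(** * Test fields with few Fourier modes *)

Section LowerBound.
Local Open Scope complex_scope.
Import Normc.
Variables (R : realType) (d : nat).

Lemma sobolev_intro (m : R) (u : fourier R d) M :
  (forall k, u k = vconj (u (- k))) -> (forall k, dot (cfreq R k) (u k) = 0) ->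
  u 0 = 0 -> bsum (sobolev_term m u) M -> sobolev m u /\ sobolev_norm m u ^+ 2 <= M.
Proof.
move=> u1 u2 u3 uM; split.
  split=> //; apply: le_lt_trans (ltry M).
  have /esum_bsum h := uM; apply: le_trans (h (sobolev_term_ge0 m u)).
  rewrite esum_mkcond; apply: le_esum => k _; case: ifP => // _.
  by rewrite lee_fin; exact: sobolev_term_ge0.
rewrite (sqr_sobolev_norm u3 uM).
by apply: le_trans (ler_norm _) (ler_norm_rsum uM).
Qed.

Variables (i0 i1 : 'I_d).
Hypothesis i01 : i0 != i1.

Definition plane_vec (T : pzRingType) (a b : T) : 'rV[T]_d :=
  \row_r (if r == i0 then a else if r == i1 then b else 0).

Lemma plane_vec_i0 (T : pzRingType) (a b : T) : plane_vec a b 0 i0 = a.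
Proof. by rewrite mxE eqxx. Qed.

Lemma plane_vec_i1 (T : pzRingType) (a b : T) : plane_vec a b 0 i1 = b.
Proof. by rewrite mxE eqxx eq_sym (negbTE i01). Qed.

Lemma plane_vec_inj (T : pzRingType) (a b a' b' : T) :
  plane_vec a b = plane_vec a' b' -> a = a' /\ b = b'.
Proof.
move=> E; split; first by rewrite -(plane_vec_i0 a b) E plane_vec_i0.
by rewrite -(plane_vec_i1 a b) E plane_vec_i1.
Qed.

Lemma plane_vec_eq (a b a' b' : int) :
  (plane_vec a b == plane_vec a' b') = (a == a') && (b == b').
Proof. by apply/eqP/andP => [/plane_vec_inj[-> ->]//|[/eqP -> /eqP ->]]. Qed.

Lemma plane_vec00 (T : pzRingType) : plane_vec 0 0 = 0 :> 'rV[T]_d.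
Proof. by apply/rowP => r; rewrite !mxE !if_same. Qed.

Lemma plane_vecN (T : pzRingType) (a b : T) : - plane_vec a b = plane_vec (- a) (- b).
Proof. by apply/rowP => r; rewrite !mxE; do 2 case: ifP => // _; rewrite oppr0. Qed.

Lemma plane_vecD (T : pzRingType) (a b a' b' : T) :
  plane_vec a b + plane_vec a' b' = plane_vec (a + a') (b + b').
Proof. by apply/rowP => r; rewrite !mxE; do 2 case: ifP => // _; rewrite addr0. Qed.

Lemma cfreq_plane_vec (a b : int) : cfreq R (plane_vec a b) = plane_vec a%:~R b%:~R.
Proof. by apply/rowP => r; rewrite !mxE; do 2 case: ifP => // _. Qed.

Lemma dot_plane_vec_l (a b : R[i]) u :
  dot (plane_vec a b) u = a * u 0 i0 + b * u 0 i1.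
Proof.
rewrite /dot (bigD1 i0)//= (bigD1 i1) ?(eq_sym i1)//= big1.
  by rewrite plane_vec_i0 plane_vec_i1 addr0.
by move=> r /andP[/negbTE r0 /negbTE r1]; rewrite !mxE r0 r1 mul0r.
Qed.

Lemma dot_plane_vec (a b a' b' : R[i]) :
  dot (plane_vec a b) (plane_vec a' b') = a * a' + b * b'.
Proof. by rewrite dot_plane_vec_l plane_vec_i0 plane_vec_i1. Qed.

Lemma vconj_plane_vec (a b : R[i]) : vconj (plane_vec a b) = plane_vec (conjc a) (conjc b).
Proof. by apply/rowP => r; rewrite !mxE; do 2 case: ifP => // _; rewrite conjc0. Qed.

Lemma sqr_vnorm_plane_vec (a b : R[i]) : vnorm (plane_vec a b) ^+ 2 = normc a ^+ 2 + normc b ^+ 2.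
Proof.
rewrite sqr_vnormE vconj_plane_vec dot_plane_vec cReD !sqr_normcE !cReM.
by case: a b => x y [z t] /=; ring.
Qed.

Lemma sqr_freq_norm_plane_vec (a b : int) : freq_norm R (plane_vec a b) ^+ 2 = a%:~R ^+ 2 + b%:~R ^+ 2.
Proof.
by rewrite /freq_norm cfreq_plane_vec sqr_vnorm_plane_vec !normc_int !real_normK ?num_real.
Qed.

Let KL_alg (D g x y u : R) :
  D * (g * (1 * (u - u * -1)) * (x * 0 + u * x * y)) = D * (2 * g * x * y * u ^+ 2).
Proof. ring. Qed.

Let sum4_alg (x y : R) : x + (x + (y + (y + 0))) = 2 * (x + y).
Proof. ring. Qed.

Section TestFields.
Variables (m : int) (al be ga : R).
Hypotheses (m0 : 0 < m) (al0 : 0 < al) (be0 : 0 < be) (ga0 : 0 < ga).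

Definition modeH : 'rV[int]_d := plane_vec m 1.
Definition modeL : 'rV[int]_d := plane_vec m (- 1).
Definition modeK : 'rV[int]_d := plane_vec (2 * m) 0.

(** The direction [(1,-m)] is orthogonal to [H] and, with the odd imaginary
    amplitude, the field is real; its sign is the one that makes
    [test_terms_ge0] true. *)
Definition test_v : fourier R d := fun h =>
  if h == modeH then plane_vec (- 'i%C * ga%:C) ('i%C * (m%:~R * ga)%:C)
  else if h == - modeH then plane_vec ('i%C * ga%:C) (- 'i%C * (m%:~R * ga)%:C) else 0.

(** [(1,m)] is orthogonal to [L], [(0,1)] is orthogonal to [K], and the two have
    the nonzero scalar product [m]. *)
Definition test_w : fourier R d := fun q =>
  if (q == modeL) || (q == - modeL) then plane_vec al%:C (m%:~R * al)%:C
  else if (q == modeK) || (q == - modeK) then plane_vec 0 be%:C else 0.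

Lemma test_v_conj h : test_v h = vconj (test_v (- h)).
Proof.
rewrite /test_v (eqr_oppLR h modeH) eqr_opp.
have Z : vconj (0 : 'rV[R[i]]_d) = 0 by apply/rowP => r; rewrite !mxE conjc0.
have HN : (modeH == - modeH) = false.
  by apply/eqP; rewrite plane_vecN => /plane_vec_inj[]; lia.
have [->|h1] := eqVneq h modeH.
  rewrite HN vconj_plane_vec; congr plane_vec; apply: complexP => /=; ring.
have [_|_] := eqVneq h (- modeH).
  rewrite vconj_plane_vec; congr plane_vec; apply: complexP => /=; ring.
by rewrite Z.
Qed.

Lemma test_w_conj q : test_w q = vconj (test_w (- q)).
Proof.
rewrite /test_w !eqr_opp !(eqr_oppLR q) [(q == - modeL) || _]orbC [(q == - modeK) || _]orbC.
have Z : vconj (0 : 'rV[R[i]]_d) = 0 by apply/rowP => r; rewrite !mxE conjc0.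
by do 2 (case: ifP => _; first by rewrite vconj_plane_vec !conjc_real ?conjc0).
Qed.

Lemma test_v_sol h : dot (cfreq R h) (test_v h) = 0.
Proof.
rewrite /test_v; case: eqVneq => [->|_].
  rewrite cfreq_plane_vec dot_plane_vec; rewrite !int_real_complex.
  by apply: complexP => /=; ring.
case: eqVneq => [->|_]; last exact: dot0r.
rewrite plane_vecN cfreq_plane_vec dot_plane_vec !int_real_complex rmorphN/=.
by apply: complexP => /=; ring.
Qed.

Lemma test_w_sol q : dot (cfreq R q) (test_w q) = 0.
Proof.
rewrite /test_w; case: ifP => [/orP[]/eqP ->|_].
- rewrite cfreq_plane_vec dot_plane_vec !int_real_complex rmorphN/=; apply: complexP => /=; ring.
- rewrite plane_vecN cfreq_plane_vec dot_plane_vec !int_real_complex !rmorphN/= ?opprK; apply: complexP => /=; ring.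
case: ifP => [/orP[]/eqP ->|_]; last exact: dot0r.
- by rewrite cfreq_plane_vec dot_plane_vec mulr0 mul0r addr0.
- by rewrite plane_vecN cfreq_plane_vec dot_plane_vec oppr0 mulr0 mul0r addr0.
Qed.

Lemma test_v0 : test_v 0 = 0.
Proof.
rewrite /test_v; case: eqP => [|_]; first by rewrite -plane_vec00 => /plane_vec_inj[]; lia.
by case: eqP => [|//]; rewrite plane_vecN -plane_vec00 => /plane_vec_inj[]; lia.
Qed.

Lemma test_w0 : test_w 0 = 0.
Proof.
rewrite /test_w; case: ifP => [/orP[]/eqP|_].
- by rewrite -plane_vec00 => /plane_vec_inj[]; lia.
- by rewrite -plane_vec00 plane_vecN => /plane_vec_inj[]; lia.
case: ifP => [/orP[]/eqP|//].
- by rewrite -plane_vec00 => /plane_vec_inj[]; lia.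
- by rewrite -plane_vec00 plane_vecN => /plane_vec_inj[]; lia.
Qed.

Lemma freq_norm_modeL : freq_norm R modeL = freq_norm R modeH.
Proof.
apply/eqP; rewrite -(@eqrXn2 _ 2) ?freq_norm_ge0// !sqr_freq_norm_plane_vec.
by rewrite rmorphN sqrrN.
Qed.

Lemma freq_norm_modeH_ge1 : 1 <= freq_norm R modeH.
Proof. by apply: freq_norm_ge1; rewrite -plane_vec00; apply/eqP => /plane_vec_inj[]; lia. Qed.

Lemma freq_norm_modeH_le_modeK : freq_norm R modeH <= freq_norm R modeK.
Proof.
rewrite -(@ler_pXn2r _ 2) ?nnegrE ?freq_norm_ge0// !sqr_freq_norm_plane_vec.
rewrite -!rmorphXn -!rmorphD/= ler_int; nia.
Qed.

Let xw (q : 'rV[int]_d) : R := if (q == modeL) || (q == - modeL) then al else 0.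
Let yw (q : 'rV[int]_d) : R := if (q == modeL) || (q == - modeL) then m%:~R * al
  else if (q == modeK) || (q == - modeK) then be else 0.
Let sv (h : 'rV[int]_d) : R := if h == modeH then 1 else if h == - modeH then -1 else 0.

Let test_wE q : test_w q = plane_vec (xw q)%:C (yw q)%:C.
Proof.
rewrite /test_w /xw /yw; case: ifP => // _.
by case: ifP => // _; rewrite plane_vec00.
Qed.

Let test_vE h : test_v h = plane_vec (- 'i%C * (sv h * ga)%:C) ('i%C * (sv h * (m%:~R * ga))%:C).
Proof.
rewrite /test_v /sv; case: ifP => _; first by rewrite !mul1r.
case: ifP => _; last by rewrite !mul0r !mulr0 plane_vec00.
by congr plane_vec; apply: complexP => /=; ring.
Qed.

Let test_trilinE k q : trilin test_v test_w k q =
  (ga * (sv (k - q) * ((q 0 i0)%:~R - m%:~R * (q 0 i1)%:~R)) *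
   (xw q * xw k + yw q * yw k))%:C.
Proof.
rewrite /trilin !test_wE test_vE vconj_plane_vec dot_plane_vec dot_plane_vec_l !mxE !int_real_complex.
by apply: complexP => /=; ring.
Qed.

Let supp q : [\/ q = modeL, q = - modeL, q = modeK | q = - modeK] \/ (xw q = 0 /\ yw q = 0).
Proof.
rewrite /xw /yw; have [->|_] := eqVneq q modeL; first by left; constructor 1.
have [->|_] := eqVneq q (- modeL); first by left; constructor 2.
have [->|_] := eqVneq q modeK; first by left; constructor 3.
have [->|_] := eqVneq q (- modeK); first by left; constructor 4.
by right.
Qed.

Let D0 (p : R) : 0 <= p -> freq_weight p modeL <= freq_weight p modeK.
Proof.
move=> p0; rewrite /freq_weight freq_norm_modeL; apply: ge0_ler_powR; rewrite ?nnegrE ?freq_norm_ge0 ?freq_norm_modeH_le_modeK//.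
by rewrite mulr_ge0.
Qed.

(** Among the sixteen pairs of modes of [w], only [(K,L)], [(L,K)], [(-L,-K)] and
    [(-K,-L)] differ by [H] or [-H]. Exchanging the two modes changes the sign of
    the weight difference and of the amplitude of [v]; passing to the opposite
    modes changes the sign of that amplitude and of the last factor. Hence no
    cancellation occurs and each term bounds the whole series from below. *)
Lemma test_terms_ge0 (p : R) k q : 0 <= p ->
  0 <= complex.Re ((freq_weight p k - freq_weight p q)%:C * trilin test_v test_w k q).
Proof.
move=> p0; rewrite test_trilinE -rmorphM/=.
have u0 : 0 < m%:~R :> R by rewrite ltr0z.
have al1 := al0; have be1 := be0; have ga1 := ga0; have m1 := m0.
have xw0 h : 0 <= xw h by rewrite /xw; case: ifP => // _; exact: ltW.
have yw0 h : 0 <= yw h.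
  by rewrite /yw; case: ifP => _; [rewrite mulr_ge0 ?ltW|case: ifP => // _; exact: ltW].
have [Hq|[-> ->]] := supp q; last by rewrite !mul0r addr0 !mulr0.
have [Hk|[-> ->]] := supp k; last by rewrite !mulr0 addr0 !mulr0.
rewrite (mulrA _ (ga * _)); apply: mulr_ge0; last by rewrite addr_ge0 ?mulr_ge0.
move: (D0 p0) u0.
(* Integer arithmetic discards the pairs whose difference is neither [H] nor [-H]. *)
case: Hk => ->; case: Hq => ->; rewrite ?freq_weightN;
  move: (freq_weight p modeL) (freq_weight p modeK) => a b ab u0;
  rewrite /sv /modeH /modeL /modeK !plane_vecN !plane_vecD ?plane_vec_i0 ?plane_vec_i1;
  (case: eqP => [/plane_vec_inj[E1 E2]|_];
    [try (exfalso; lia)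
    | case: eqP => [/plane_vec_inj[E1 E2]|_];
      [try (exfalso; lia)|by rewrite mul0r !mulr0]]).
all: have P : 0 <= (b - a) * (ga * m%:~R) by rewrite !mulr_ge0 ?subr_ge0 ?(ltW u0) ?(ltW ga1).
all: clear E1 E2.
all: rewrite ?mulrNz ?intrM ?mulrNz ?mulr1z ?mulr0z; move: m%:~R u0 P => u u0 P; nra.
Qed.

Lemma test_term_KL (p : R) :
  complex.Re ((freq_weight p modeK - freq_weight p modeL)%:C * trilin test_v test_w modeK modeL) =
  (freq_weight p modeK - freq_weight p modeL) * (2 * ga * al * be * m%:~R ^+ 2).
Proof.
rewrite test_trilinE -rmorphM/= /modeL /modeK /sv /xw /yw /modeH /modeL /modeK !plane_vecN !plane_vecD.
rewrite !plane_vec_i0 !plane_vec_i1.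
rewrite !plane_vec_eq.
have m1 := m0.
rewrite (_ : 2 * m - m = m); last by lia.
rewrite (_ : 0 - -1 = 1 :> int) // !eqxx /=.
rewrite (_ : (2 * m == m) = false); last by lia.
rewrite (_ : (2 * m == - m) = false); last by lia.
rewrite /= mulrN1z. exact: KL_alg.
Qed.

Let a := freq_norm R modeH.
Let b := freq_norm R modeK.

Let sqr_a : a ^+ 2 = m%:~R ^+ 2 + 1.
Proof. by rewrite sqr_freq_norm_plane_vec expr1n. Qed.

Let normc_i_real (x : R) : normc ('i%C * x%:C) ^+ 2 = x ^+ 2.
Proof. by rewrite normcM normci mul1r normc_real real_normK ?num_real. Qed.

Lemma test_v_sobolev (r : R) : sobolev r test_v /\
  sobolev_norm r test_v ^+ 2 <= 2 * (a `^ (2 * r) * (ga ^+ 2 * a ^+ 2)).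
Proof.
apply: sobolev_intro; [exact: test_v_conj|exact: test_v_sol|exact: test_v0|].
have HN : modeH != - modeH by apply/eqP; rewrite plane_vecN => /plane_vec_inj[]; have := m0; lia.
have nH : vnorm (test_v modeH) ^+ 2 = ga ^+ 2 * a ^+ 2.
  rewrite test_vE /sv eqxx !mul1r sqr_vnorm_plane_vec.
  have -> : - 'i%C * ga%:C = 'i%C * (- ga)%:C by apply: complexP => /=; ring.
  by rewrite !normc_i_real sqr_a; ring.
have nHN : vnorm (test_v (- modeH)) = vnorm (test_v modeH).
  by rewrite [in RHS]test_v_conj vnorm_vconj.
have fs k : k \notin [:: modeH; - modeH] -> sobolev_term r test_v k = 0.
  rewrite !inE negb_or /sobolev_term /test_v => /andP[/negbTE -> /negbTE ->].
  by rewrite vnorm0 expr0n mulr0.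
apply: bsum_widen (bsum_finsupp fs).
rewrite undup_id /= ?inE ?HN// !big_cons big_nil.
rewrite !ger0_norm ?sobolev_term_ge0// /sobolev_term freq_normN nHN nH -/a.
by rewrite le_eqVlt; apply/orP; left; apply/eqP; ring.
Qed.

Lemma test_w_sobolev (r : R) : sobolev r test_w /\
  sobolev_norm r test_w ^+ 2 <=
    2 * (a `^ (2 * r) * (al ^+ 2 * a ^+ 2) + b `^ (2 * r) * be ^+ 2).
Proof.
apply: sobolev_intro; [exact: test_w_conj|exact: test_w_sol|exact: test_w0|].
have m1 := m0.
have LK : (modeK == modeL) || (modeK == - modeL) = false.
  by rewrite /modeL /modeK plane_vecN !plane_vec_eq; lia.
have nL : vnorm (test_w modeL) ^+ 2 = al ^+ 2 * a ^+ 2.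
  rewrite /test_w eqxx /= sqr_vnorm_plane_vec !normc_real !real_normK ?num_real// sqr_a; ring.
have nK : vnorm (test_w modeK) ^+ 2 = be ^+ 2.
  rewrite /test_w LK eqxx /= sqr_vnorm_plane_vec !normc_real !real_normK ?num_real//.
  by rewrite ?normc0 ?normr0 expr0n add0r.
have nN q : vnorm (test_w (- q)) = vnorm (test_w q).
  by rewrite [in RHS]test_w_conj vnorm_vconj.
have fs k : k \notin [:: modeL; - modeL; modeK; - modeK] -> sobolev_term r test_w k = 0.
  rewrite !inE !negb_or /sobolev_term /test_w.
  move=> /andP[/negbTE -> /andP[/negbTE -> /andP[/negbTE -> /negbTE ->]]].
  by rewrite vnorm0 expr0n mulr0.
apply: bsum_widen (bsum_finsupp fs).
rewrite undup_id; last by rewrite /= !inE /modeL /modeK !plane_vecN !plane_vec_eq; lia.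
rewrite !big_cons big_nil.
rewrite !ger0_norm ?sobolev_term_ge0// /sobolev_term !freq_normN !nN nL nK freq_norm_modeL -/a -/b.
by rewrite sum4_alg.
Qed.

End TestFields.
End LowerBound.

(** * Lower bound for the Kato constant *)

Section KatoLower.
Local Open Scope complex_scope.
Import Normc.
Variable R : realType.

Let ratio_le (X Y A N B G m2 : R) : 0 < Y -> Y < X -> 0 < A -> 0 < N -> 0 < B -> 1 <= m2 ->
  B * ((X * X - Y * Y) * (2 * Y^-1 * Y^-1 * X^-1 * m2)) <=
    16 * G * (A ^+ 3 * (N / Y)) ->
  B * (X / Y - 1) <= 8 * A ^+ 3 * N * G.
Proof.
move=> Y0 YX A0 N0 B0 m1 h; have X0 : 0 < X by exact: lt_trans YX.
have P : 0 < Y / 2 by rewrite divr_gt0.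
have -> : 8 * A ^+ 3 * N * G = (Y / 2) * (16 * G * (A ^+ 3 * (N / Y))).
  by field; rewrite gt_eqF.
apply: le_trans (ler_wpM2l (ltW P) h).
have -> : Y / 2 * (B * ((X * X - Y * Y) * (2 * Y^-1 * Y^-1 * X^-1 * m2))) =
   (B * (X / Y - 1)) * ((1 + Y / X) * m2).
  by field; rewrite !gt_eqF.
have YX1 : 1 <= 1 + Y / X by rewrite lerDl divr_ge0 ?(ltW Y0) ?(ltW X0).
rewrite ler_peMr//; last exact: mulr_ege1.
by rewrite mulr_ge0 ?(ltW B0)// subr_ge0 ler_pdivlMr// mul1r ltW.
Qed.

Let rhs_le (G V W Vn Wn c e : R) : 0 <= G -> 0 <= c -> 0 <= e ->
  0 <= V <= 2 * c -> 0 <= W <= 2 * c -> 0 <= Vn <= 2 * (e * c) -> 0 <= Wn <= 2 * (e * c) ->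
  2 * (2^-1 * G * (V * Wn + Vn * W) * W) <= 16 * G * (c ^+ 3 * e).
Proof.
move=> G0 c0 e0 /andP[V0 Vc] /andP[W0 Wc] /andP[Vn0 Vnc] /andP[Wn0 Wnc].
have -> : 2 * (2^-1 * G * (V * Wn + Vn * W) * W) = G * ((V * Wn + Vn * W) * W) by field.
have -> : 16 * G * (c ^+ 3 * e) =
  G * ((2 * c * (2 * (e * c)) + 2 * (e * c) * (2 * c)) * (2 * c)) by ring.
apply: ler_wpM2l => //; apply: ler_pM => //; first by rewrite addr_ge0 ?mulr_ge0.
by apply: lerD; apply: ler_pM.
Qed.

Let v_alg (P Q A e : R) : P * Q = e ^+ 2 ->
  2 * (P * (Q * A ^+ 2)) <= (2 * (e * A)) ^+ 2.
Proof.
move=> PQ; have -> : (2 * (e * A)) ^+ 2 = 2 * (e ^+ 2 * A ^+ 2) + 2 * (e * A) ^+ 2 by ring.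
by rewrite (mulrA P) PQ lerDl mulr_ge0 ?sqr_ge0.
Qed.

Let w_alg (P Q P' Q' A e f : R) : P * Q = e ^+ 2 -> P' * Q' = f ^+ 2 ->
  0 <= f -> f <= e -> 1 <= A ->
  2 * (P * (Q * A ^+ 2) + P' * Q') <= (2 * (e * A)) ^+ 2.
Proof.
move=> PQ PQ' f0 fe A1; rewrite (mulrA P) PQ PQ'.
have -> : (2 * (e * A)) ^+ 2 = 2 * (e ^+ 2 * A ^+ 2 + (e * A) ^+ 2) by ring.
rewrite ler_wpM2l// lerD2l ler_pXn2r// ?nnegrE//.
  by apply: (le_trans fe); rewrite ler_peMr// (le_trans f0 fe).
by rewrite mulr_ge0// ?(le_trans f0 fe)// (le_trans ler01 A1).
Qed.

(** With amplitudes [a^(-p)] and [b^(-p)], the norm of order [r <= p] of both test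
    fields is at most [2 a^(r-p) a], while the term [(K,L)] is at least of the
    order of [(b^p - a^p) a^(-2p)]. *)
Lemma kato_lower (d : nat) (i0 i1 : 'I_d) (m : int) (n p G a b : R) :
  a = freq_norm R (modeH i0 i1 m) -> b = freq_norm R (modeK i0 i1 m) -> i0 != i1 -> 0 < m ->
  d%:R / 2 + 1 < n -> n <= p -> kato_bound d p n G ->

  basis_const R d * ((b / a) `^ p - 1) <= 8 * a ^+ 3 * a `^ n * G.
Proof.
move=> aE bE i01 m0 dn np hG.
have d0 : (0 < d)%N := leq_ltn_trans (leq0n i0) (ltn_ord i0).
have dp : 0 <= d%:R / 2 :> R by rewrite divr_ge0.
have p1 : 1 <= p by lra.
have p0 : 0 < p by lra.
have a1 : 1 <= a by rewrite aE; exact: freq_norm_modeH_ge1.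
have a0 : 0 < a by lra.
have sqa : a ^+ 2 = m%:~R ^+ 2 + 1 by rewrite aE sqr_freq_norm_plane_vec// expr1n.
have sqb : b ^+ 2 = (2 * m%:~R) ^+ 2 by rewrite bE sqr_freq_norm_plane_vec// expr0n addr0 intrM.
have m1 : 1 <= m%:~R :> R by rewrite (_ : 1 = 1%:~R)// ler_int.
have mm1 : 1 <= m%:~R ^+ 2 :> R by rewrite expr2; exact: mulr_ege1.
have ab : a < b.
  rewrite -(@ltr_pXn2r _ 2) ?nnegrE ?aE ?bE ?freq_norm_ge0// -aE -bE sqa sqb exprMn expr2; lra.
have b0 : 0 < b by exact: lt_trans ab.
pose X := b `^ p; pose Y := a `^ p.
have Y0 : 0 < Y by exact: powR_gt0.
have X0 : 0 < X by exact: powR_gt0.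
have YX : Y < X by apply: gt0_ltr_powR; rewrite ?nnegrE ?(ltW a0) ?(ltW b0).
pose v := test_v i0 i1 m Y^-1; pose w := test_w i0 i1 m Y^-1 X^-1.
have iY0 : 0 < Y^-1 by rewrite invr_gt0.
have iX0 : 0 < X^-1 by rewrite invr_gt0.
have vS r : sobolev r v /\ sobolev_norm r v ^+ 2 <= 2 * (a `^ (2 * r) * (Y^-1 ^+ 2 * a ^+ 2)).
  by rewrite aE; exact: test_v_sobolev.
have wS r : sobolev r w /\ sobolev_norm r w ^+ 2 <=
    2 * (a `^ (2 * r) * (Y^-1 ^+ 2 * a ^+ 2) + b `^ (2 * r) * X^-1 ^+ 2).
  by rewrite aE bE; exact: test_w_sobolev.
have E (c r : R) : 0 < c -> c `^ (2 * r) * (c `^ p)^-1 ^+ 2 = (c `^ (r - p)) ^+ 2.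
  move=> c0; rewrite (mulrC 2) powRrM powR_mulrn ?powR_ge0// powRB ?(gt_eqF c0) ?implybT//.
  by rewrite exprMn.
have vN r : 0 <= sobolev_norm r v <= 2 * (a `^ (r - p) * a).
  rewrite sobolev_norm_ge0/= -(@ler_pXn2r _ 2) ?nnegrE ?sobolev_norm_ge0//; last first.
    by rewrite !mulr_ge0 ?powR_ge0 ?(ltW a0).
  have [_ h] := vS r; apply: le_trans h _.
  exact: v_alg (E a r a0).
have wN r : r <= p -> 0 <= sobolev_norm r w <= 2 * (a `^ (r - p) * a).
  move=> rp; rewrite sobolev_norm_ge0/= -(@ler_pXn2r _ 2) ?nnegrE ?sobolev_norm_ge0//; last first.
    by rewrite !mulr_ge0 ?powR_ge0 ?(ltW a0).
  have [_ h] := wS r; apply: le_trans h _.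
  apply: (w_alg (E a r a0) (E b r b0) (powR_ge0 _ _) _ a1).
  rewrite -(opprB p r) !powRN lef_pV2 ?posrE ?powR_gt0//.
  by apply: ge0_ler_powR; rewrite ?nnegrE ?subr_ge0 ?(ltW a0) ?(ltW b0) ?(ltW ab).
have e0 : a `^ (p - p) * a = a by rewrite subrr powRr0 mul1r.
have [vp vp2] := (proj1 (vS p), vN p).
have wp2 := wN p (lexx p); have vn2 := vN n; have wn2 := wN n np.
have wp1 := proj1 (wS (p + 1)).
rewrite e0 in vp2 wp2.
have [S S0 hS] := sobolev_l1 d0 dn.
have id := euler_sym_identity p1 np hS vp wp1.
have cb := sym_trilin_cbsum p1 np hS vp wp1.
set F := (fun i : 'rV[int]_d * 'rV[int]_d => _) in cb.
have F0 i : 0 <= complex.Re (F i).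
  by apply: (test_terms_ge0 i01 m0 iY0 iX0 iY0); exact: ltW.
have FKL := bsum_term (modeK i0 i1 m, modeL i0 i1 m) (rsum_ge0_bsum F0 (cbsum_Re cb)).
rewrite ger0_norm// in FKL.
have := hG v w vp wp1; rewrite normcE => hI.
have B0 := basis_const_gt0 R d.
have low : basis_const R d * complex.Re (F (modeK i0 i1 m, modeL i0 i1 m)) <=
    2 * normc (sobolev_inner p (euler_bilin v w) w).
  apply: (@le_trans _ _ (complex.Re (2%:R * sobolev_inner p (euler_bilin v w) w))).
    rewrite id cReM /= mul0r subr0; apply: ler_wpM2l => //; exact: ltW.
  apply: le_trans (ler_norm _) (le_trans (ler_Re_normc _) _).
  have -> : (2%:R : R[i]) = (2%:R : R)%:C by rewrite rmorph_nat.
  by rewrite normcM normc_real ger0_norm.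
have T : complex.Re (F (modeK i0 i1 m, modeL i0 i1 m)) =
    (X * X - Y * Y) * (2 * Y^-1 * Y^-1 * X^-1 * m%:~R ^+ 2).
  by rewrite (test_term_KL i01 m0 iY0 iX0 iY0) !freq_weightE freq_norm_modeL// -aE -bE.
rewrite T in low.
have {}low := le_trans low (ler_wpM2l (ler0n R 2) hI).
have Tp : 0 < basis_const R d * ((X * X - Y * Y) * (2 * Y^-1 * Y^-1 * X^-1 * m%:~R ^+ 2)).
  rewrite mulr_gt0// mulr_gt0//; first by rewrite subr_gt0 ltr_pM// ltW.
  by rewrite !mulr_gt0// (lt_le_trans ltr01).
have G0 : 0 <= G.
  rewrite leNgt; apply/negP => Gn.
  have : 2 * (2^-1 * G * (sobolev_norm p v * sobolev_norm n w +
    sobolev_norm n v * sobolev_norm p w) * sobolev_norm p w) <= 0.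
    rewrite -!mulrA mulVKf// nmulr_rle0// mulr_ge0 ?addr_ge0 ?mulr_ge0 ?sobolev_norm_ge0//.
  by move=> /(le_trans low); rewrite leNgt Tp.
have up := rhs_le G0 (ltW a0) (powR_ge0 _ _) vp2 wp2 vn2 wn2.
have {}low := le_trans low up.
have XYE : (b / a) `^ p = X / Y.
  by rewrite powRM ?invr_ge0 ?(ltW a0) ?(ltW b0)// -powR_inv1 ?(ltW a0)// powRAC powR_inv1 ?powR_ge0.
rewrite XYE; apply: (ratio_le Y0 YX a0 (powR_gt0 n a0) B0 mm1).
by rewrite -powRB ?(gt_eqF a0) ?implybT.
Qed.

End KatoLower.

(** * The minimum and its limit *)

Section SharpConstant.
Variable R : realType.

(** The admissible constants are defined by inequalities that are linear in the
    constant with a nonnegative coefficient, so that their infimum is again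
    admissible. *)
Lemma kato_constP (d : nat) (n p U L : R) : kato_bound d p n U ->
  (forall G, kato_bound d p n G -> L <= G) ->
  kato_bound d p n (kato_const d p n) /\
  forall G, kato_bound d p n G -> kato_const d p n <= G.
Proof.
move=> hU hL; pose B : set R := [set G | kato_bound d p n G].
have lB : has_lbound B by exists L => G; exact: hL.
have ex : exists G, [set G : R | kato_bound d p n G /\
    forall G', kato_bound d p n G' -> G <= G'] G.
  exists (inf B); split; last by move=> G hG; apply: ge_inf.
  move=> v w vp wp.
  have N0 (q : R) u : 0 <= sobolev_norm q u :> R := sobolev_norm_ge0 q u.
  set C := sobolev_norm p v * sobolev_norm n w + sobolev_norm n v * sobolev_norm p w.
  have C0 : 0 <= C * sobolev_norm p w.
    by rewrite mulr_ge0// addr_ge0// mulr_ge0.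
  rewrite -[leRHS]mulrA (mulrC 2^-1) -mulrA.
  (* For a vanishing coefficient the inequality does not depend on the constant. *)
  have [Z|Z] := eqVneq (C * sobolev_norm p w) 0.
    by rewrite Z !mulr0; have := hU v w vp wp; rewrite -/C -mulrA Z mulr0.
  have Cp : 0 < 2^-1 * (C * sobolev_norm p w) by rewrite mulr_gt0// lt_neqAle eq_sym Z.
  rewrite -ler_pdivrMr//; apply: lb_le_inf; first by exists U.
  move=> G hG; rewrite ler_pdivrMr//; have := hG v w vp wp.
  by rewrite -/C -mulrA (mulrC 2^-1) -mulrA.
exact: (getPex ex).
Qed.

(** [x^p = expR (p ln x / 2)^2 >= (p ln x / 2)^2]. *)
Lemma linear_le_powR (C x : R) : 1 < x -> \forall p \near +oo, C * p <= x `^ p.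
Proof.
move=> x1; have l0 : 0 < ln x by exact: ln_gt0.
have x0 : 0 < x by lra.
near=> p.
have p0 : 0 < p by near: p; exact: nbhs_pinfty_gt (num_real _).
have pC : 4 * C / ln x ^+ 2 <= p by near: p; exact: nbhs_pinfty_ge (num_real _).
rewrite /powR gt_eqF// (splitr (p * ln x)) expRD.
have h : p * ln x / 2 <= expR (p * ln x / 2).
  by apply: le_trans (expR_ge1Dx _); rewrite lerDr.
apply: (@le_trans _ _ ((p * ln x / 2) * (p * ln x / 2))); last first.
  have q0 : 0 <= p * ln x / 2 by rewrite !mulr_ge0 ?(ltW p0) ?(ltW l0).
  exact: ler_pM.
have -> : p * ln x / 2 * (p * ln x / 2) = (ln x ^+ 2 / 4 * p) * p by field.
rewrite ler_wpM2r ?(ltW p0)//.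
have L4 : 0 < ln x ^+ 2 / 4 by rewrite divr_gt0// exprn_gt0.
apply: (@le_trans _ _ (ln x ^+ 2 / 4 * (4 * C / ln x ^+ 2))); last by apply: ler_wpM2l => //; exact: ltW.
by rewrite le_eqVlt; apply/orP; left; apply/eqP; field; rewrite gt_eqF.
Unshelve. all: by end_near. Qed.

(** The squared ratio is [4 m^2 / (m^2 + 1)], and any [m > 2 / e] is large enough. *)
Lemma ratio_near2 (d : nat) (i0 i1 : 'I_d) (e : R) : i0 != i1 -> 0 < e -> e <= 1 ->
  exists2 m : int, 0 < m & 2 - e < freq_norm R (modeK i0 i1 m) / freq_norm R (modeH i0 i1 m).
Proof.
move=> i01 e0 e1; pose m := Num.trunc (2 / e); exists (m.+1%:Z) => //.
have a1 : 1 <= freq_norm R (modeH i0 i1 m.+1%:Z) by apply: freq_norm_modeH_ge1.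
have a0 : 0 < freq_norm R (modeH i0 i1 m.+1%:Z) by apply: lt_le_trans a1.
rewrite ltr_pdivlMr// -(@ltr_pXn2r _ 2) ?nnegrE ?freq_norm_ge0//; last first.
  by rewrite mulr_ge0 ?(ltW a0)//; lra.
rewrite exprMn !sqr_freq_norm_plane_vec// expr1n expr0n addr0 intrM exprMn.
have hm : 2 / e < m.+1%:R by exact: truncnS_gt.
rewrite ltr_pdivrMr// in hm.
have -> : (m.+1%:Z)%:~R = m.+1%:R :> R by [].
have M1 : 1 <= m.+1%:R :> R by rewrite ler1n.
set M : R := m.+1%:R in hm M1 *.
have h1 : 2 * M <= M * M * e by rewrite -mulrA [2 * M]mulrC ler_wpM2l ?(ltW hm).
nra.
Qed.

End SharpConstant.

Unset Implicit Arguments.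
Set Strict Implicit.
Set Printing Implicit Defensive.

Theorem proposition11p2 (R : realType) (d : nat) (n : R)
    (hd : (2 <= d)%N) (hn : d%:R / 2 + 1 < n) :
  kato_const d p n `^ (p^-1) @[p --> +oo] --> (2 : R).
Proof.
have d0 : (0 < d)%N by exact: ltnW.
pose i0 : 'I_d := Ordinal d0; pose i1 : 'I_d := Ordinal hd.
have i01 : i0 != i1 by [].
have dp : 0 <= d%:R / 2 :> R by rewrite divr_ge0.
have [C C0 upper] := kato_upper d0 hn.
have low m p G : 0 < m -> n <= p -> kato_bound d p n G ->
    basis_const R d * ((freq_norm R (modeK i0 i1 m) / freq_norm R (modeH i0 i1 m)) `^ p - 1) <=
    8 * freq_norm R (modeH i0 i1 m) ^+ 3 * freq_norm R (modeH i0 i1 m) `^ n * G.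
  by move=> m0 np hG; exact: (kato_lower (erefl _) (erefl _) i01 m0 hn np hG).
have B0 := basis_const_gt0 R d.
have low' m : 0 < m -> exists2 c : R, 0 < c & forall p G, n <= p -> kato_bound d p n G ->
    c * ((freq_norm R (modeK i0 i1 m) / freq_norm R (modeH i0 i1 m)) `^ p - 1) <= G.
  move=> m0; set a := freq_norm R (modeH i0 i1 m).
  have a1 : 1 <= a by exact: freq_norm_modeH_ge1.
  have a0 : 0 < a by exact: lt_le_trans a1.
  have K0 : 0 < 8 * a ^+ 3 * a `^ n by rewrite !mulr_gt0 ?exprn_gt0 ?powR_gt0.
  exists (basis_const R d / (8 * a ^+ 3 * a `^ n)); first exact: divr_gt0.
  move=> p G np hG; rewrite mulrAC ler_pdivrMr// mulrC [leRHS]mulrC.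
  rewrite [leLHS]mulrC; exact: low.
have spec p : n <= p -> kato_bound d p n (kato_const d p n) /\
    forall G, kato_bound d p n G -> kato_const d p n <= G.
  move=> np; have [c c0 h] := low' 1 isT.
  apply: kato_constP (upper p np) _ => G; exact: h.
apply/cvgrPdist_le => e0 e00.
(* [e <= 1] keeps the base [2 - e] above [1]. *)
pose e := Num.min e0 1; have e0' : 0 < e by rewrite lt_min e00 ltr01.
have e1 : e <= 1 by rewrite ge_min lexx orbT.
have [m m0 rm] := ratio_near2 i01 e0' e1.
have [c c0 hc] := low' m m0.
set r := _ / _ in rm hc; pose s : R := 2 - e.
have s1 : 1 <= s by rewrite /s; lra.
have s0 : 0 < s by lra.
have rs : 1 < r / s by rewrite ltr_pdivlMr// mul1r.
near=> p.
have np : n <= p by near: p; exact: nbhs_pinfty_ge (num_real _).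
have p1 : 1 <= p by lra.
have p0 : 0 < p by lra.
have [kb kmin] := spec p np.
have up : C * p <= (1 + e / 2) `^ p.
  by near: p; apply: linear_le_powR; lra.
have lo : (1 + c) / c * p <= (r / s) `^ p.
  by near: p; apply: linear_le_powR.
set K := kato_const d p n in kb kmin *.
have sp : 1 <= s `^ p by rewrite -(powRr0 s); apply: ler_powR => //; exact: ltW.
(* The strict inequality [s < r] absorbs the constant [c] and the term [- 1]. *)
have Klow : s `^ p <= K.
  apply: le_trans (hc p K np kb).
  have E : r `^ p = (r / s) `^ p * s `^ p.
    rewrite -powRM ?divfK// ?gt_eqF// ?(ltW s0)//.
    by rewrite ltW// (lt_trans ltr01).
  have h1 : (1 + c) / c <= (r / s) `^ p.
    apply: le_trans lo; rewrite ler_peMr// divr_ge0 ?(ltW c0)// addr_ge0 ?(ltW c0)//.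
  have h2 : (1 + c) * s `^ p <= c * r `^ p.
    rewrite E mulrA ler_wpM2r ?powR_ge0// mulrC -ler_pdivrMr//.
  by rewrite mulrBr mulr1; move: h2; rewrite mulrDl mul1r; nra.
have Kup : K <= (2 + e) `^ p.
  apply: le_trans (kmin _ (upper p np)) _.
  have -> : 2 + e = (1 + e / 2) * 2 by field.
  rewrite powRM//; last by lra.
  by rewrite ler_wpM2r// powR_ge0.
have root x : 0 < x -> (x `^ p) `^ p^-1 = x.
  by move=> x0; rewrite -powRrM divff ?gt_eqF// powRr1// ltW.
have K0 : 0 <= K by apply: le_trans Klow; exact: powR_ge0.
have l1 : s <= K `^ p^-1.
  rewrite -[leLHS](root s s0); apply: ge0_ler_powR; rewrite ?nnegrE ?powR_ge0//.
  by rewrite invr_ge0 ltW.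
have l2 : K `^ p^-1 <= 2 + e.
  rewrite -[leRHS](root (2 + e)); last by lra.
  apply: ge0_ler_powR; rewrite ?nnegrE ?powR_ge0//.
  by rewrite invr_ge0 ltW.
have ee : e <= e0 by rewrite ge_min lexx.
by rewrite ler_norml; apply/andP; split; rewrite /s in l1; lra.
Unshelve. all: by end_near. Qed.
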